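(* Let $N=2M\geq 8$ be even and not a multiple of $3$, let $\gamma=0$, and let $k\in\{1,\dots,\lfloor N/6\rfloor\}$. Each $1$-saddle in $C_k$ connects exactly one local minimum in $B_{k-1}$ with one local minimum in $B_k$. More precisely, if the coordinates of the saddle have values $\alpha'_0,\alpha'_1,\alpha'_2$, and those of the local minima in $B_{k-1}$ and $B_k$ are respectively $\alpha_1,\alpha_2$ and $\alpha''_1,\alpha''_2$, then the connection rules, giving site by site the coordinate of the local minimum in $B_{k-1}$, of the saddle in $C_k$ and of the local minimum in $B_k$, are $$\alpha_1\longleftrightarrow\alpha'_0\longleftrightarrow\alpha''_2\quad\text{(1 coordinate)},$$ $$\alpha_1\longleftrightarrow\alpha'_1\longleftrightarrow\alpha''_1\quad\text{($M-k$ coordinates)},$$ $$\alpha_2\longleftrightarrow\alpha'_2\longleftrightarrow\alpha''_2\quad\text{($M+k-1$ coordinates)}.$$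
   Context: Let $V_0(x)=\sum_{i=1}^N\bigl(\tfrac14x_i^4-\tfrac12x_i^2\bigr)$ on $\mathbb{R}^N$ and $S=\{x\in\mathbb{R}^N:\sum_ix_i=0\}$. Stationary points are critical points of $V_0|_S$, i.e. points $x\in S$ with $x_i^3-x_i=\lambda$ for all $i$ and some $\lambda\in\mathbb{R}$. The index of a stationary point is the number of negative eigenvalues of the Hessian of $V_0|_S$; local minima have index $0$ and $1$-saddles have index $1$. A $1$-saddle $z$ connects two local minima if the two connected components (branches) of its one-dimensional unstable manifold, for the negative gradient flow of $V_0|_S$ on $S$, converge to these two local minima. Triple: when $N$ is not a multiple of $3$, every stationary point has $|\lambda|<\frac{2}{3\sqrt3}$, so $\xi^3-\xi-\lambda$ has three distinct real roots $\alpha_0,\alpha_1,\alpha_2$; letting $a_j$ be the number of coordinates equal to $\alpha_j$ and numbering the roots so that $a_0\leq a_1\leq a_2$, the triple is $(a_0,a_1,a_2)$. For $k\in\{0,\dots,\lfloor N/6\rfloor\}$, $B_k$ is the set of all local minima with triple $(0,M-k,M+k)$; for $k\in\{1,\dots,\lfloor N/6\rfloor\}$, $C_k$ is the set of all $1$-saddles with triple $(1,M-k,M+k-1)$. In each of these families the coordinates are labelled according to this convention: for a point with triple $(a_0,a_1,a_2)$ the coordinate value with subscript $j$ occurs $a_j$ times (for points of $B_0$, where $a_1=a_2=M$ and the coordinates are $\pm1$, either labelling of the two values may occur). *)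

(* Defs.v *)
From HB Require Import structures.
From mathcomp Require Import all_boot all_order all_algebra.
From mathcomp Require Import all_classical all_reals all_analysis.
From mathcomp Require Import ring.
Set Implicit Arguments.
Unset Strict Implicit.
Unset Printing Implicit Defensive.
Import Order.TTheory GRing.Theory Num.Theory.
Import numFieldNormedType.Exports.
Local Open Scope classical_set_scope.
Local Open Scope ring_scope.

Section Potential.
Variables (R : realType) (N : nat).
Implicit Types x y z : 'rV[R]_N.

Definition V0 x : R :=
  \sum_(i < N) (x ord0 i ^+ 4 / 4%:R - x ord0 i ^+ 2 / 2%:R).

Definition zero_sum : set 'rV[R]_N := [set x | \sum_(i < N) x ord0 i = 0].

(* Orthogonal projector onto [zero_sum] for the Euclidean inner product, acting
   on row vectors from the right; its row space is [zero_sum]. *)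
Definition projS : 'M[R]_N := 1%:M - N%:R^-1 *: const_mx 1.

Definition grad (f : 'rV[R]_N -> R) x : 'rV[R]_N :=
  \row_i 'D_(delta_mx ord0 i) f x.

Definition hess (f : 'rV[R]_N -> R) x : 'M[R]_N :=
  \matrix_(i, j)
    'D_(delta_mx ord0 i) (fun y => 'D_(delta_mx ord0 j) f y) x.

(* S := [zero_sum] is a linear subspace, so the gradient and the Hessian of the
   restriction of V0 to S (with the induced inner product) are the projected
   ones.  The Hessian is the endomorphism v |-> v *m hess V0 x *m projS of S,
   written in the basis [row_base projS] of S. *)
Definition gradS x : 'rV[R]_N := grad V0 x *m projS.

Definition hessS x : 'M[R]_(\rank projS) :=
  restrictmx projS (hess V0 x *m projS).

Definition stationary x : Prop := zero_sum x /\ gradS x = 0.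

Lemma is_derive_coord x (v : 'rV[R]_N) j :
  is_derive x v (fun y : 'rV[R]_N => y ord0 j) (v ord0 j).
Proof.
have dx : derivable (fun y : 'rV[R]_N => y) x v by exact: derivable_id.
split; first exact: ((derivable_mxP _ _ _).1 dx).
have /matrixP/(_ ord0 j) := derive_mx dx.
by rewrite mxE derive_id.
Qed.

Lemma is_derive_V0 x (v : 'rV[R]_N) :
  is_derive x v V0 (\sum_i (x ord0 i ^+ 3 - x ord0 i) * v ord0 i).
Proof.
pose c i (y : 'rV[R]_N) : R := y ord0 i.
have -> : V0 = \sum_i (4^-1 \*: c i ^+ 4 - 2^-1 \*: c i ^+ 2).
  apply/funext => y; rewrite fct_sumE; apply: eq_bigr => i _.
  rewrite !fctE /c /GRing.scale/=.
  by rewrite [in LHS]mulrC [y ord0 i ^+ 2 / _]mulrC.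
apply: is_derive_sum => i.
have dc : is_derive x v (c i) (v ord0 i) by exact: is_derive_coord.
apply: is_derive_eq.
by rewrite /GRing.scale/= /c; field.
Qed.

Lemma gradE x : grad V0 x = \row_i (x ord0 i ^+ 3 - x ord0 i).
Proof.
apply/rowP => i; rewrite !mxE (@derive_val _ _ _ _ _ _ _ (is_derive_V0 _ _)).
rewrite (bigD1 i)//= big1 ?addr0 => [|j /negPf ji]; rewrite mxE eqxx /=.
  by rewrite eqxx mulr1.
by rewrite ji mulr0.
Qed.

Lemma hessE x : hess V0 x = diag_mx (\row_i (3 * x ord0 i ^+ 2 - 1)).
Proof.
apply/matrixP => i j; rewrite !mxE.
have -> : (fun y => 'D_(delta_mx ord0 j) V0 y) =
    (fun y : 'rV[R]_N => y ord0 j) ^+ 3 - (fun y : 'rV[R]_N => y ord0 j).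
  apply/funext => y; have /rowP/(_ j) := gradE y; rewrite !mxE => ->.
  by rewrite !fctE.
have dc := is_derive_coord x (delta_mx ord0 i) j.
rewrite derive_val !mxE eqxx /= eq_sym /GRing.scale/=.
by case: eqP => [->|_]; rewrite ?mulr1n ?mulr0n; ring.
Qed.

Lemma stationaryP x : (0 < N)%N ->
  stationary x <->
  zero_sum x /\ exists lam : R, forall i, x ord0 i ^+ 3 - x ord0 i = lam.
Proof.
move=> N0; have N0' : N%:R != 0 :> R by rewrite pnatr_eq0 -lt0n.
have gE i : gradS x ord0 i = (x ord0 i ^+ 3 - x ord0 i) -
    N%:R^-1 * \sum_j (x ord0 j ^+ 3 - x ord0 j).
  rewrite /gradS gradE mulmxBr mulmx1 -scalemxAr !mxE; congr (_ - _ * _).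
  by apply: eq_bigr => j _; rewrite !mxE mulr1.
split=> -[x0 xs]; split=> //.
  exists (N%:R^-1 * \sum_j (x ord0 j ^+ 3 - x ord0 j)) => i.
  by apply/eqP; rewrite -subr_eq0 -gE xs mxE.
case: xs => lam xs; apply/rowP => i; rewrite gE mxE xs.
under eq_bigr do rewrite xs.
by rewrite sumr_const card_ord -[lam *+ N]mulr_natl mulKf ?subrr.
Qed.

Lemma zero_sumP x : (0 < N)%N -> zero_sum x <-> (x <= projS)%MS.
Proof.
move=> N0; have N0' : N%:R != 0 :> R by rewrite pnatr_eq0 -lt0n.
split=> [x0|/submxP[y ->]].
  suff <- : x *m projS = x by exact: submxMl.
  rewrite mulmxBr mulmx1 -scalemxAr; apply/rowP => i; rewrite !mxE.
  under eq_bigr do rewrite mxE mulr1.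
  by rewrite [X in _ * X]x0 mulr0 subr0.
have yE i : (y *m projS) ord0 i =
    y ord0 i - N%:R^-1 * \sum_j y ord0 j.
  rewrite mulmxBr mulmx1 -scalemxAr !mxE; congr (_ - _ * _).
  by apply: eq_bigr => j _; rewrite !mxE mulr1.
rewrite /zero_sum/=; under eq_bigr do rewrite yE.
by rewrite big_split/= sumr_const card_ord -[_ *+ N]mulr_natl mulrN mulVKf ?subrr.
Qed.


(* [s] lists the eigenvalues of the Hessian with multiplicity. *)
Definition has_index x (n : nat) : Prop :=
  exists s : seq R,
    char_poly (hessS x) = \prod_(a <- s) ('X - a%:P) /\
    count (fun a => a < 0) s = n.

Definition local_minimum x : Prop :=
  [/\ stationary x, has_index x 0 &
      \forall y \near x, zero_sum y -> V0 x <= V0 y].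

Definition one_saddle x : Prop := stationary x /\ has_index x 1.

(* The point x has triple (a0, a1, a2), and al0, al1, al2 are the three roots
   numbered accordingly.  When two of the a's coincide the numbering is not
   unique, and every admissible one satisfies the predicate. *)
Definition labelled_triple x (a0 a1 a2 : nat) (al0 al1 al2 : R) : Prop :=
  exists lam : R,
    [/\ forall i, x ord0 i ^+ 3 - x ord0 i = lam,
        uniq [:: al0; al1; al2],
        {in [:: al0; al1; al2], forall xi, xi ^+ 3 - xi - lam = 0},
        [/\ #|[set i | x ord0 i == al0]%SET| = a0,
            #|[set i | x ord0 i == al1]%SET| = a1 &
            #|[set i | x ord0 i == al2]%SET| = a2] &
        (a0 <= a1 <= a2)%N].

Definition has_triple x (a0 a1 a2 : nat) : Prop :=
  exists al0 al1 al2 : R, labelled_triple x a0 a1 a2 al0 al1 al2.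

Definition B (M k : nat) : set 'rV[R]_N :=
  [set x | local_minimum x /\ has_triple x 0 (M - k) (M + k)].

Definition C (M k : nat) : set 'rV[R]_N :=
  [set x | one_saddle x /\ has_triple x 1 (M - k) (M + k - 1)].

Definition flow_line (g : R -> 'rV[R]_N) : Prop :=
  forall t : R, zero_sum (g t) /\ is_derive t 1 g (- gradS (g t)).

(* Trajectories in the unstable manifold of a stationary point are defined for
   all times, the restriction of V0 to S being coercive. *)
Definition unstable_manifold z : set 'rV[R]_N :=
  [set y | exists g, [/\ flow_line g, g 0 = y & g t @[t --> -oo] --> z]].

Definition branches z : set (set 'rV[R]_N) :=
  [set connected_component (unstable_manifold z `\ z) y
    | y in unstable_manifold z `\ z].

Definition converges_to (b : set 'rV[R]_N) x : Prop :=
  forall g, flow_line g -> b (g 0) -> g t @[t --> +oo] --> x.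

Definition connects z x y : Prop :=
  exists b1 b2 : set 'rV[R]_N,
    [/\ b1 <> b2, branches z = [set b1; b2],
        converges_to b1 x & converges_to b2 y].

End Potential.

(* Main.v *)
Require Import Defs.
From HB Require Import structures.
From mathcomp Require Import all_boot all_order all_algebra.
From mathcomp Require Import all_classical all_reals all_analysis.
From mathcomp Require Import ring lra zify.

(** Write f(s) = s^3 - s, so that the flow is x_i' = - f(x_i) + mean of the
    f(x_j).  For two sites i and j the difference d = x_i - x_j satisfies the
    linear equation d' = d (1 - (x_i^2 + x_i x_j + x_j^2)).  Hence equal
    coordinates stay equal, and if z_i = z_j is a value with 3 z_i^2 > 1 then an
    orbit that leaves the saddle z has x_i = x_j at all times, for otherwise d
    would grow backwards in time ([flow_line_back_eq]).  So the unstable manifold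
    lies in the plane of the points with coordinate u on the site of al0', v on
    the m = M - k sites of al1' and w on the n = M + k - 1 sites of al2', where
    u + m v + n w = 0.

    In the coordinates p = u - v and q = w - u the lines p = 0, q = 0 and
    ell = (2m - n - 1) p - (2n - m - 1) q = 0 are invariant, and
    (log (p / q))' = (p + q) ell / N.  The line ell = 0 passes through 0 and the
    saddle, and the saddle is the only orbit on it that tends to the saddle
    backwards in time ([planar_center]).  On the side ell > 0 the ratio q / p
    decreases to 0: the coordinate u merges with w, and the limit is a point of
    B_k ([planar_forward]).  The side ell < 0 is the same situation with (m, p)
    and (n, q) exchanged: u merges with v, and the limit is in B_(k-1).

    On each side the unstable manifold is a single orbit.  The field is a linear
    term plus a homogeneous cubic one, which makes the planar system integrable.
    With x = ell / q there are constants a, b, kap, B, D such that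
    log q - t - a log (B + x) - b log (D + x) + (kap / 2) log x is constant
    along the orbits; this turns the equation of x into Phi(x^kap) = const e^(2t), where
    Phi is an antiderivative of an explicit positive function.  Inverting Phi
    yields one orbit that starts at the saddle, and every other one is a shift of
    it in time ([reduced_unstable], [planar_unstable]).  The two orbits are
    connected and are separated by the sign of ell, so they are the branches
    ([saddle_connection]).

    The limit points have two coordinate values, and both are local minima of
    s^4 / 4 - s^2 / 2 - lam s, where lam is the Lagrange multiplier: this gives
    the local minimality.  For the index, the projected Hessian is annihilated by
    a product of distinct linear factors with nonnegative roots
    ([two_valued_index0]).  Finally 1, M - k, M + k - 1 are distinct, and so are
    M - k and M + k, so the labels of the values are determined by the numbers of
    occurrences. *)

Set Implicit Arguments.
Unset Strict Implicit.
Unset Printing Implicit Defensive.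
Import Order.TTheory GRing.Theory Num.Theory.
Import numFieldNormedType.Exports.
Local Open Scope classical_set_scope.
Local Open Scope ring_scope.

(** * Differentiation rules and linear differential equations *)

Section RealDerivatives.
Variable R : realType.
Implicit Types (f g : R -> R) (x : R).

Lemma deriv_cst (c x : R) : is_derive x 1 (fun _ : R => c) 0.
Proof. exact: is_derive_cst. Qed.

Lemma deriv_id x : is_derive x 1 (fun t : R => t) 1.
Proof. exact: is_derive_id. Qed.

Lemma derivD f g x df dg : is_derive x 1 f df -> is_derive x 1 g dg ->
  is_derive x 1 (fun t => f t + g t) (df + dg).
Proof. by move=> hf hg; exact: is_deriveD. Qed.

Lemma derivB f g x df dg : is_derive x 1 f df -> is_derive x 1 g dg ->
  is_derive x 1 (fun t => f t - g t) (df - dg).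
Proof. by move=> hf hg; exact: is_deriveB. Qed.

Lemma derivN f x df : is_derive x 1 f df ->
  is_derive x 1 (fun t => - f t) (- df).
Proof. by move=> hf; exact: is_deriveN. Qed.

Lemma derivM f g x df dg : is_derive x 1 f df -> is_derive x 1 g dg ->
  is_derive x 1 (fun t => f t * g t) (df * g x + f x * dg).
Proof.
move=> hf hg; apply: (is_derive_eq (is_deriveM hf hg)).
by rewrite /GRing.scale/=; ring.
Qed.

Lemma derivV f x df : f x != 0 -> is_derive x 1 f df ->
  is_derive x 1 (fun t => (f t)^-1) (- df / f x ^+ 2).
Proof.
move=> fx hf; apply: (is_derive_eq (is_deriveV fx hf)).
by rewrite /GRing.scale/= mulrC mulrN mulNr.
Qed.

Lemma derivX2 f x df : is_derive x 1 f df ->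
  is_derive x 1 (fun t => f t ^+ 2) (2 * f x * df).
Proof. by move=> hf; apply: (is_derive_eq (derivM hf hf)); ring. Qed.

Lemma deriv_expR f x df : is_derive x 1 f df ->
  is_derive x 1 (fun t => expR (f t)) (expR (f x) * df).
Proof. by move=> hf; exact: (is_derive1_comp (is_derive_expR (f x)) hf). Qed.

Lemma deriv_ln f x df : 0 < f x -> is_derive x 1 f df ->
  is_derive x 1 (fun t => ln (f t)) (df / f x).
Proof.
move=> f0 hf; rewrite mulrC.
exact: (is_derive1_comp (is_derive1_ln f0) hf).
Qed.

Lemma deriv_shift f (s x df : R) : is_derive (x + s) 1 f df ->
  is_derive x 1 (fun t => f (t + s)) df.
Proof.
move=> hf; rewrite -[df]mulr1.
have hs : is_derive x 1 (fun t => t + s) 1.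
  by apply: (is_derive_eq (derivD (deriv_id x) (deriv_cst s x))); rewrite addr0.
exact: (@is_derive1_comp _ f (fun t => t + s) x df 1 hf hs).
Qed.

Lemma derivable_continuous f x : derivable f x 1 -> {for x, continuous f}.
Proof. by move=> df; apply/differentiable_continuous/derivable1_diffP. Qed.

End RealDerivatives.

(** Differentiates a composite function whose parts have their derivatives in the
    context.  The rules are chosen by the syntax of the function: unifying with
    them instead would unfold the operations of the abstract field. *)
Ltac deriv :=
  lazymatch goal with
  | |- is_derive _ _ (fun _ => ?c) _ => exact: deriv_cst
  | |- is_derive _ _ (fun t => t) _ => exact: deriv_id
  | |- is_derive _ _ (fun t => @?f t ^+ 2) _ =>
      notypeclasses refine (@derivX2 _ f _ _ _); deriv
  | |- is_derive _ _ (fun t => @?f t * @?g t) _ =>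
      notypeclasses refine (@derivM _ f g _ _ _ _ _); deriv
  | |- is_derive _ _ (fun t => @?f t - @?g t) _ =>
      notypeclasses refine (@derivB _ f g _ _ _ _ _); deriv
  | |- is_derive _ _ (fun t => - @?f t) _ =>
      notypeclasses refine (@derivN _ f _ _ _); deriv
  | |- is_derive _ _ (fun t => @?f t + @?g t) _ =>
      notypeclasses refine (@derivD _ f g _ _ _ _ _); deriv
  | |- is_derive _ _ (fun t => (@?f t)^-1) _ =>
      notypeclasses refine (@derivV _ f _ _ _ _); [cbv beta|deriv]
  | |- is_derive _ _ (fun t => expR (@?f t)) _ =>
      notypeclasses refine (@deriv_expR _ f _ _ _); deriv
  | |- is_derive _ _ (fun t => ln (@?f t)) _ =>
      notypeclasses refine (@deriv_ln _ f _ _ _ _); [cbv beta|deriv]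
  | |- is_derive ?x ?v (fun t => ?p t) ?d =>
      change (is_derive x v p d); deriv
  | H : is_derive _ _ ?f _ |- is_derive _ _ ?f _ => exact: H
  | H : forall t : _, is_derive t _ ?f _ |- is_derive _ _ ?f _ => exact: H
  end.

Ltac deriv_eq := notypeclasses refine (is_derive_eq _ _); [deriv|cbv beta].

Lemma cvg_sqr (R : realType) (T : Type) (F : set_system T) {FF : Filter F}
    (u : T -> R) (l : R) :
  u t @[t --> F] --> l -> u t ^+ 2 @[t --> F] --> l ^+ 2.
Proof.
by move=> ul; rewrite expr2; under eq_fun do rewrite expr2; exact: cvgM.
Qed.

Lemma is_derive_derivable (R : realType) (f : R -> R) (t d : R) :
  is_derive t (1 : R) f d -> derivable f t 1.
Proof. by case. Qed.

Ltac derivable := notypeclasses refine (is_derive_derivable _); deriv.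

Section RealODE.
Variable R : realType.
Implicit Types (f g d a : R -> R).

Lemma deriv_ge0_le f f' (a b : R) : (forall t : R, is_derive t (1 : R) f (f' t)) ->
  a <= b -> (forall t, a <= t <= b -> 0 <= f' t) -> f a <= f b.
Proof.
move=> df ab f'0; rewrite -subr_ge0.
have [|c cab ->] := @MVT_segment R f f' a b ab (fun t _ => df t).
  apply: continuous_subspaceT => t; apply: derivable_continuous.
  by case: (df t).
by apply: mulr_ge0; rewrite ?subr_ge0//; apply: f'0; move: cab; rewrite in_itv.
Qed.

Lemma deriv_gt0_lt f f' (a b : R) : (forall t : R, is_derive t (1 : R) f (f' t)) ->
  a < b -> (forall t, a < t < b -> 0 < f' t) -> f a < f b.
Proof.
move=> df ab f'0; rewrite -subr_gt0.
have [|c cab ->] := @MVT R f f' a b ab (fun t _ => df t).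
  apply: continuous_subspaceT => t; apply: derivable_continuous.
  by case: (df t).
by apply: mulr_gt0; rewrite ?subr_gt0//; apply: f'0; move: cab; rewrite in_itv.
Qed.

(** The lower bound of the integral depends on the point, so that the theorem on
    integrals over a segment applies at every real; subtracting the value at 0
    makes the result independent of this bound. *)
Lemma antiderivative f : continuous f ->
  exists F : R -> R, F 0 = 0 /\ forall t : R, is_derive t (1 : R) F (f t).
Proof.
move=> cf; pose G (n x : R) : R := \int[lebesgue_measure]_(t in `[- n, x]) f t.
have intf (x y : R) : lebesgue_measure.-integrable `[x, y] (EFin \o f).
  apply: continuous_compact_integrable; first exact: segment_compact.
  exact: continuous_subspaceT.
have GB (n m x : R) : n <= m -> - n <= x -> G m x - G m (- n) = 
    \int[lebesgue_measure]_(t in `]- n, x]) f t.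
  move=> nm nx; by rewrite /G Rintegral_itvB ?bnd_simp ?lerN2.
have GE (n m x : R) : 0 < n -> n <= m -> - n <= x -> G m x - G m 0 = G n x - G n 0.
  move=> n0 nm nx; have n0' : - n <= 0 by rewrite oppr_le0 ltW.
  have h y : - n <= y -> G m y = G m (- n) + (G n y - G n (- n)).
    by move=> ny; rewrite (GB n n)// -(GB n m)//; ring.
  by rewrite (h x)// (h 0)//; ring.
exists (fun x => G (`|x| + 1) x - G (`|x| + 1) 0); split.
  by rewrite subrr.
move=> x; pose m := `|x| + 3.
apply: (@near_eq_is_derive _ _ _ (fun y => G m y - G m 0)).
  near=> y; apply: GE.
  - by rewrite ltr_wpDl.
  - have yx : `|x - y| < 1.
      have : ball x 1 y by near: y; exact: (@nbhsx_ballx _ _ x (1 : R) ltr01).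
      by rewrite -ball_normE.
    have := ler_normB x (x - y); rewrite subKr /m; lra.
  - have := ler_norm (- y); rewrite normrN; lra.
rewrite -[f x]subr0; apply: derivB.
have xx1 : x < x + 1 by rewrite ltrDl.
have mx : - m < x by rewrite /m; have := ler_norm (- x); rewrite normrN; lra.
have [dG GfE] := continuous_FTC1_closed xx1 (intf _ _) mx (cf x).
by split; rewrite -?derive1E.
Unshelve. all: by end_near. Qed.

(** The factor E is the exponential of an antiderivative of the rate. *)
Lemma linear_ode d a : (forall t : R, is_derive t (1 : R) d (d t * a t)) ->
  (forall t : R, derivable a t 1) ->
  exists E : R -> R, forall s t, 0 < E t / E s /\ d t = d s * (E t / E s).
Proof.
move=> dd da.
have [F [_ dF]] : exists F : R -> R, F 0 = 0 /\ forall t : R, is_derive t (1 : R) F (a t).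
  by apply: antiderivative => t; exact: derivable_continuous.
exists (fun t => expR (F t)) => s t; split; first by rewrite divr_gt0 ?expR_gt0.
have /(_ t s) : forall t s : R, d t * expR (- F t) = d s * expR (- F s).
  move=> t' s'; apply: is_derive_0_is_cst (fun t => d t * expR (- F t)) _ _ _ => u.
  by deriv_eq; ring.
rewrite !expRN => e.
by rewrite mulrCA -e mulrC mulfVK// gt_eqF// expR_gt0.
Qed.

Lemma linear_ode_gt0 d a (s t : R) :
  (forall t : R, is_derive t (1 : R) d (d t * a t)) ->
  (forall t : R, derivable a t 1) -> 0 < d s -> 0 < d t.
Proof.
by move=> dd /(linear_ode dd)[E /(_ s t)[E0 ->]] ds; rewrite mulr_gt0.
Qed.

Lemma linear_ode_eq0 d a (s t : R) :
  (forall t : R, is_derive t (1 : R) d (d t * a t)) ->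
  (forall t : R, derivable a t 1) -> d s = 0 -> d t = 0.
Proof.
by move=> dd /(linear_ode dd)[E /(_ s t)[E0 ->]] ->; rewrite mul0r.
Qed.

(** Backwards in time a solution with nonpositive rate cannot shrink, so the
    only one that tends to 0 is 0. *)
Lemma linear_ode_back_eq0 d a :
  (forall t : R, is_derive t (1 : R) d (d t * a t)) ->
  (forall t : R, derivable a t 1) ->
  (\forall t \near -oo, a t <= 0) -> d t @[t --> -oo] --> 0 ->
  forall t, d t = 0.
Proof.
move=> dd da [T [_ aT]] d0 t; apply: (linear_ode_eq0 (s := T - 1) t dd da).
have d2 : d t ^+ 2 @[t --> -oo] --> 0.
  rewrite -[0](mulr0 0); exact: (cvg_sqr d0).
have : d (T - 1) ^+ 2 <= 0.
  apply: (cvgr_to_ge d2); exists (T - 1); split; first exact: num_real.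
  move=> s sT; rewrite -lerN2.
  apply: (@deriv_ge0_le (fun t => - d t ^+ 2) (fun t => 2 * d t ^+ 2 * - a t)).
  - by move=> u; deriv_eq; ring.
  - exact: ltW.
  move=> u /andP[_ uT]; have au : a u <= 0 by apply: aT; lra.
  by rewrite mulr_ge0 ?oppr_ge0// mulr_ge0 ?sqr_ge0.
by rewrite le_eqVlt ltNge sqr_ge0 orbF sqrf_eq0 => /eqP.
Qed.

(** After T the function e^(2t) (h - C) is nonincreasing. *)
Lemma relaxation_ode_le (h b : R -> R) (C T t : R) :
  (forall t : R, is_derive t (1 : R) h (2 * b t - 2 * h t)) ->
  (forall t, T <= t -> b t <= C) -> T <= t ->
  h t <= C + expR (2 * (T - t)) * (h T - C).
Proof.
move=> dh bC Tt.
have : expR (2 * T) * (C - h T) <= expR (2 * t) * (C - h t).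
  apply: (@deriv_ge0_le (fun t => expR (2 * t) * (C - h t))
           (fun t => expR (2 * t) * (2 * (C - b t)))) => //.
    by move=> u; deriv_eq; ring.
  move=> u /andP[Tu _]; rewrite mulr_ge0 ?expR_ge0// mulr_ge0// subr_ge0.
  exact: bC.
rewrite [2 * (T - t)]mulrBr expRD expRN => h1.
have e0 : 0 < expR (2 * t) by exact: expR_gt0.
rewrite -lerBlDl -(ler_pM2l e0) mulrA mulrCA mulfV ?gt_eqF// mulr1.
by move: h1; lra.
Qed.

Lemma expR_decay_cvg0 (c K : R) : 0 < c ->
  K * expR (- (c * t)) @[t --> +oo] --> 0.
Proof.
move=> c0; have h : expR (- (c * t)) @[t --> +oo] --> 0.
  apply: (@cvg_comp _ _ _ (fun t => c * t) (fun t => expR (- t)) _ (pinfty_nbhs R)).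
    by apply: gt0_cvgMry => //; exact: cvg_id.
  exact: cvgr_expR.
by rewrite -[0](mulr0 K); apply: cvgM => //; exact: cvg_cst.
Qed.

(** The lower estimate is this one for the opposites of h and b. *)
Lemma relaxation_ode_cvg_le (h b : R -> R) (C e : R) :
  (forall t : R, is_derive t (1 : R) h (2 * b t - 2 * h t)) ->
  (\forall t \near +oo, b t <= C) -> 0 < e -> \forall t \near +oo, h t <= C + e.
Proof.
move=> dh [T [_ bC]] e0.
have bC' t : T + 1 <= t -> b t <= C by move=> Tt; apply: bC; lra.
have k0 := expR_decay_cvg0 (expR (2 * (T + 1)) * (h (T + 1) - C)) (ltr0n R 2).
near=> t; apply: (le_trans (relaxation_ode_le dh bC' _)).
  by near: t; exact: (nbhs_pinfty_ge (num_real _)).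
rewrite lerD2l [2 * (T + 1 - t)]mulrBr expRD mulrAC; near: t.
exact: (cvgr_le _ k0 e e0).
Unshelve. all: by end_near. Qed.

Lemma relaxation_ode_cvg (h b : R -> R) (l : R) :
  (forall t : R, is_derive t (1 : R) h (2 * b t - 2 * h t)) ->
  b t @[t --> +oo] --> l -> h t @[t --> +oo] --> l.
Proof.
move=> dh bl; apply/cvgrPdist_le => e e0.
have e2 : 0 < e / 2 by rewrite divr_gt0.
have up := relaxation_ode_cvg_le dh (cvgr_le l bl (l + e / 2) _) e2.
have dhN t : is_derive t (1 : R) (fun t => - h t) (2 * - b t - 2 * - h t).
  by deriv_eq; ring.
have blN : - b t @[t --> +oo] --> - l by exact: cvgN.
have dn := relaxation_ode_cvg_le dhN (cvgr_le (- l) blN (- l + e / 2) _) e2.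
near=> t; rewrite ler_distl; apply/andP; split.
  have : h t <= l + e / 2 + e / 2 by near: t; apply: up; rewrite ltrDl.
  lra.
have : - h t <= - l + e / 2 + e / 2 by near: t; apply: dn; rewrite ltrDl.
lra.
Unshelve. all: by end_near. Qed.

Lemma decay_ode_cvg0 (e r : R -> R) (m : R) :
  (forall t : R, is_derive t (1 : R) e (- (e t * r t))) ->
  (forall t, 0 <= e t) -> 0 < m -> (forall t, 0 <= t -> m <= r t) ->
  e t @[t --> +oo] --> 0.
Proof.
move=> de e0 m0 rm.
have le_e t : 0 <= t -> e t <= e 0 * expR (- (m * t)).
  move=> t0; have : - (expR (m * 0) * e 0) <= - (expR (m * t) * e t).
    apply: (@deriv_ge0_le (fun t => - (expR (m * t) * e t))
      (fun t => expR (m * t) * (e t * (r t - m)))) => //.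
      by move=> u; deriv_eq; ring.
    move=> u /andP[u0 _]; rewrite mulr_ge0 ?expR_ge0// mulr_ge0// subr_ge0.
    exact: rm.
  rewrite mulr0 expR0 mul1r lerN2 => h.
  by rewrite expRN ler_pdivlMr ?expR_gt0// mulrC.
apply: (@squeeze_cvgr _ _ _ _ (fun=> 0) (fun t => e 0 * expR (- (m * t)))).
- near=> t; rewrite e0/=; apply: le_e; near: t; exact: (nbhs_pinfty_ge (num_real _)).
- exact: cvg_cst.
- exact: expR_decay_cvg0.
Unshelve. all: by end_near. Qed.

End RealODE.

(** * A change of time *)

Section TimeChange.
Variable R : realType.

(** Truncation at 0 extends the power continuously to the whole line, which lets
    the saddle itself, at parameter 0, be an interior point in what follows. *)
Lemma continuous_max0_powR (c : R) : 0 < c ->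
  continuous (fun x : R => Num.max x 0 `^ c).
Proof.
move=> c0 x; have [x0|x0|->] := ltgtP x (0 : R).
- apply: derivable_continuous.
  apply: (@near_eq_derivable _ _ _ (cst (0 : R))); last exact: derivable_cst.
  near=> y; have y0 : y < 0 by near: y; exact: lt_nbhsl.
  by rewrite (max_idPr (ltW y0)) powR0// gt_eqF.
- apply: derivable_continuous.
  apply: (@near_eq_derivable _ _ _ (fun y : R => y `^ c)).
    near=> y; have y0 : 0 < y by near: y; exact: lt_nbhsr.
    by rewrite (max_idPl (ltW y0)).
  by case: (is_derive1_powR c x0).
- rewrite /continuous_at maxxx powR0 ?gt_eqF//; apply/cvgrPdist_le => e e0.
  near=> y; rewrite sub0r normrN ger0_norm ?powR_ge0//.
  have -> : e = (e `^ c^-1) `^ c.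
    by rewrite -powRrM mulVf ?gt_eqF// powRr1// ltW.
  apply: ge0_ler_powR; rewrite ?nnegrE ?powR_ge0// ?(ltW c0)//.
    by rewrite le_max lexx orbT.
  rewrite ge_max powR_ge0 andbT; near: y.
  by apply: lt_le_nbhsl; rewrite powR_gt0.
Unshelve. all: by end_near. Qed.

(** Inverts an antiderivative Phi of psi along e^(2t), that is, solves the
    separable equation psi(eta) eta' = 2 e^(2t) for the solution that leaves 0 at
    time -oo.  The lower bound c / x on psi makes Phi unbounded, so that eta is
    defined at all times. *)
Lemma time_change (psi : R -> R) (c : R) : continuous psi ->
  (forall x, 0 < psi x) -> 0 < c -> (forall x, 1 <= x -> c <= x * psi x) ->
  exists Phi eta : R -> R,
    [/\ Phi 0 = 0, forall x : R, is_derive x (1 : R) Phi (psi x), injective Phi,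
        forall t, 0 < eta t /\ Phi (eta t) = expR (2 * t) &
        (forall t : R, is_derive t (1 : R) eta (2 * expR (2 * t) / psi (eta t))) /\
        eta t @[t --> -oo] --> 0].
Proof.
move=> cpsi psi0 c0 cle; have [Phi [Phi0 dPhi]] := antiderivative cpsi.
have Phi_lt x y : x < y -> Phi x < Phi y.
  by move=> xy; apply: (deriv_gt0_lt dPhi xy) => t _.
have Phi_inj : injective Phi.
  by move=> x y xy; have [/Phi_lt|/Phi_lt|//] := ltgtP x y; rewrite xy ltxx.
have Phi_cont : continuous Phi.
  by move=> x; apply: derivable_continuous; case: (dPhi x).
have Phi_surj y : 0 < y -> exists2 x, 0 < x & Phi x = y.
  move=> y0; pose T := expR (y / c).
  have yT : Phi 1 - c * 0 <= Phi T - c * (y / c).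
    rewrite -[X in Phi X - _]expR0.
    apply: (@deriv_ge0_le _ (fun s => Phi (expR s) - c * s)
              (fun s => expR s * psi (expR s) - c)).
    - move=> s; have := is_derive1_comp (dPhi (expR s)) (is_derive_expR s).
      by rewrite -[_ \o _]/(fun s => Phi (expR s)) => h; deriv_eq; ring.
    - by rewrite divr_ge0// ltW.
    - by move=> s /andP[s0 _]; rewrite subr_ge0 cle// -expR0 ler_expR.
  have {}yT : y < Phi T.
    have := Phi_lt 0 1 ltr01; rewrite Phi0; move: yT.
    by rewrite mulr0 mulrCA mulfV ?gt_eqF//; lra.
  have T0 : 0 <= T by exact: expR_ge0.
  have [||x xT xy] := @IVT R Phi 0 T y T0.
  - exact: continuous_subspaceT.
  - rewrite Phi0 (min_idPl _) ?(max_idPr _) ?(ltW y0) ?(ltW yT)//;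
    exact/ltW/(lt_trans y0).
  exists x => //; rewrite lt_neqAle; move: xT; rewrite in_itv/= => /andP[-> _].
  by rewrite andbT eq_sym; apply: contraTneq y0 => x0; rewrite -xy x0 Phi0 ltxx.
pose g (y : R) : R := xget 0 [set x | Phi x = y].
have gK : cancel Phi g.
  move=> x; apply: Phi_inj; rewrite /g.
  by apply: (xgetPex 0 (P := [set x' | Phi x' = Phi x])); exists x.
have Phi_g y : 0 < y -> 0 < g y /\ Phi (g y) = y.
  by move=> /Phi_surj[x x0 <-]; rewrite gK.
have dg x : is_derive (Phi x) (1 : R) g (psi x)^-1.
  apply: (is_derive_inverse _ _ (dPhi x)); last by rewrite gt_eqF.
  - by near=> y; exact: gK.
  - by near=> y; exact: Phi_cont.
have e0 t : 0 < expR (2 * t) :> R by exact: expR_gt0.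
exists Phi, (fun t => g (expR (2 * t))); split=> //.
  by move=> t; exact: Phi_g.
split.
  move=> t; have [_ PE] := Phi_g _ (e0 t).
  have := dg (g (expR (2 * t))); rewrite PE => dge.
  have de : is_derive t (1 : R) (fun t => expR (2 * t)) (expR (2 * t) * 2).
    by deriv_eq; ring.
  have := @is_derive1_comp R g (fun t => expR (2 * t)) t _ _ dge de.
  rewrite -[_ \o _]/(fun t => g (expR (2 * t))) => h.
  by apply: (is_derive_eq h); ring.
have -> : 0 = g 0 by rewrite -Phi0 gK.
apply: (@cvg_comp _ _ _ (fun t => expR (2 * t)) g _ (nbhs (0 : R))); last first.
  by rewrite -Phi0; apply: derivable_continuous; case: (dg 0).
apply/cvgNy_compNP.
have := expR_decay_cvg0 (1 : R) (ltr0n R 2).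
by apply: cvg_trans; apply: near_eq_cvg; near=> t; rewrite /= mul1r mulrN.
Unshelve. all: by end_near. Qed.

End TimeChange.

(** * The integrable system of the ratio and the scale *)

(** Here x is ell / q.  For x = 0 the system describes the invariant line of the
    saddle, and q alone then tends to a limit; x measures the distance to it. *)
Section ReducedSystem.
Variables (R : realType) (a b kap K B D : R).
Hypotheses (kap0 : 0 < kap) (K0 : 0 < K) (B0 : 0 < B) (BD : B <= D).

Definition reduced_rate (x : R) : R :=
  (kap / 2 * (B + x) * (D + x) - a * x * (D + x) - b * x * (B + x)) / K.

Definition reduced_flow (x q : R -> R) :=
  forall t : R,
    is_derive t (1 : R) x (x t * ((B + x t) * (D + x t) * q t ^+ 2 / K)) /\
    is_derive t (1 : R) q (q t * (1 - reduced_rate (x t) * q t ^+ 2)).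

Let D0 : 0 < D. Proof. exact: lt_le_trans BD. Qed.

(** The first integral says that q^2 is a multiple of e^(2t) weight(x) / x^kap,
    and [density] is what then multiplies the derivative of x^kap in the
    separated equation; [root] recovers x from x^kap, also at 0. *)
Let weight (x : R) : R := expR (2 * a * ln (B + x) + 2 * b * ln (D + x)).
Let density (x : R) : R := (weight x * ((B + x) * (D + x)))^-1.
Let root (x : R) : R := Num.max x 0 `^ kap^-1.

Let root_gt0E (x : R) : 0 < x -> root x = expR (ln x / kap).
Proof.
by move=> x0; rewrite /root (max_idPl (ltW x0)) /powR gt_eqF// mulrC.
Qed.

Let root_ge0 (x : R) : 0 <= root x. Proof. exact: powR_ge0. Qed.

Let density_gt0 (x : R) : 0 <= x -> 0 < density x.
Proof.
move=> x0; rewrite invr_gt0 mulr_gt0 ?expR_gt0//.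
by rewrite mulr_gt0// ltr_wpDr.
Qed.

Let continuous_weight (x : R) : 0 <= x -> {for x, continuous weight}.
Proof.
move=> x0; apply: derivable_continuous; rewrite /weight.
by derivable; rewrite ltr_wpDr.
Qed.

Let continuous_density (x : R) : 0 <= x -> {for x, continuous density}.
Proof.
move=> x0; apply: derivable_continuous; rewrite /density /weight.
derivable; try by rewrite ltr_wpDr.
by rewrite -invr_eq0 gt_eqF//; exact: density_gt0.
Qed.

(** Since the exponent of D + x is nonnegative and D >= B, the density at y is at
    least (B + y)^(- (2 + 2 a + 2 b)), hence for y >= 1 at least a positive
    multiple of y^(- kap). *)
Let density_lower (x : R) : 1 + 2 * b <= 0 -> 2 + 2 * a + 2 * b <= kap ->
  1 <= x -> expR (- (kap * ln (B + 1))) <= x * density (root x).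
Proof.
move=> hb hab x1; have x0 : 0 < x by lra.
rewrite root_gt0E//; set L := ln x / kap; set y := expR L.
have L0 : 0 <= L by rewrite divr_ge0 ?ln_ge0// ltW.
have y1 : 1 <= y by rewrite /y -[leLHS]expR0 ler_expR.
have xE : x = expR (kap * L).
  by rewrite /L mulrCA mulfV ?gt_eqF// mulr1 lnK ?posrE.
have y0 : 0 < y by exact: expR_gt0.
have By0 : 0 < B + y by exact: addr_gt0.
have Dy0 : 0 < D + y by exact: addr_gt0.
have B10 : 0 < B + 1 by exact: addr_gt0.
have l1_ge0 : 0 <= ln (B + y) by rewrite ln_ge0// ler_wpDl// ltW.
have l12 : ln (B + y) <= ln (D + y) by rewrite ler_ln ?posrE// lerD2r.
have l1_le : ln (B + y) <= ln (B + 1) + L.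
  rewrite -[L](expRK L) -lnM ?posrE ?expR_gt0// -/y.
  rewrite ler_ln ?posrE ?mulr_gt0// mulrDl mul1r lerD2r.
  by rewrite ler_peMr// ltW.
have -> : density y = expR (- ((1 + 2 * a) * ln (B + y) + (1 + 2 * b) * ln (D + y))).
  rewrite /density /weight expRN; congr (_^-1).
  rewrite -{2}[B + y]lnK ?posrE// -{2}[D + y]lnK ?posrE// -!expRD.
  by congr expR; ring.
rewrite {1}xE -expRD ler_expR.
have h1 : (1 + 2 * b) * ln (D + y) <= (1 + 2 * b) * ln (B + y).
  exact: ler_wnM2l.
have h2 : (2 + 2 * a + 2 * b) * ln (B + y) <= kap * ln (B + y).
  exact: ler_wpM2r.
have h3 : kap * ln (B + y) <= kap * (ln (B + 1) + L) by rewrite ler_pM2l.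
by move: h1 h2 h3; lra.
Qed.

(** The orbit is built by separation of variables.  For another orbit the value
    J 0 of the first integral differs by s from the value j of the constructed
    one, and this is the shift in time.  The limit of q^2 at -oo exists because
    Phi(eta) / eta tends to the derivative of Phi at 0. *)
Lemma reduced_unstable : 1 + 2 * b <= 0 -> 2 + 2 * a + 2 * b <= kap ->
  exists x q : R -> R,
    [/\ reduced_flow x q, forall t, 0 < x t /\ 0 < q t,
        x t @[t --> -oo] --> 0,
        q t ^+ 2 @[t --> -oo] --> 2 * K / (kap * (B * D)) &
        forall x1 q1 : R -> R, reduced_flow x1 q1 ->
          (forall t, 0 < x1 t /\ 0 < q1 t) -> x1 t @[t --> -oo] --> 0 ->
          exists s, forall t, x1 t = x (t + s) /\ q1 t = q (t + s)].
Proof.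
move=> hb hab; have kapN0 : kap != 0 by rewrite gt_eqF.
have KN0 : K != 0 by rewrite gt_eqF.
have cpsi : continuous (fun u => density (root u)).
  move=> u; apply: (@continuous_comp _ _ _ root density).
    by apply: continuous_max0_powR; rewrite invr_gt0.
  exact: continuous_density.
have psi0 u : 0 < density (root u) by exact: density_gt0.
have [Phi [eta [Phi0 dPhi Phi_inj eta_spec [deta eta_cvg]]]] :=
  time_change cpsi psi0 (expR_gt0 _) (fun u => density_lower hb hab).
have eta0 t : 0 < eta t by case: (eta_spec t).
have PhiE t : Phi (eta t) = expR (2 * t) by case: (eta_spec t).
pose j := ln (2 * K / kap) / 2.
have jE : expR (2 * j) = 2 * K / kap.
  by rewrite /j mulrC divfK// lnK// posrE divr_gt0// mulr_gt0.
pose L t := ln (eta t) / kap; pose x t := expR (L t).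
have xE t : root (eta t) = x t by rewrite root_gt0E.
have x0 t : 0 < x t by exact: expR_gt0.
have Bx0 t : 0 < B + x t by rewrite addr_gt0.
have Dx0 t : 0 < D + x t by rewrite addr_gt0.
pose lq t := j + t + a * ln (B + x t) + b * ln (D + x t) - kap / 2 * L t.
pose q t := expR (lq t).
have q0 t : 0 < q t by exact: expR_gt0.
have etaE t : eta t = expR (kap * L t).
  by rewrite /L mulrCA mulfV// mulr1 lnK ?posrE.
have q2E t : q t ^+ 2 = 2 * K / kap * expR (2 * t) * weight (x t) / eta t.
  rewrite -jE /q /weight etaE -expRN -!expRD -expRM_natl; congr expR.
  by rewrite /lq; field.
have dL (t : R) : is_derive t (1 : R) L ((B + x t) * (D + x t) * q t ^+ 2 / K).
  rewrite /L; deriv_eq; first exact: eta0.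
  have w0 : weight (x t) != 0 by rewrite gt_eqF ?expR_gt0.
  have e0 : eta t != 0 by rewrite gt_eqF.
  have h1 : B + x t != 0 by rewrite gt_eqF.
  have h2 : D + x t != 0 by rewrite gt_eqF.
  rewrite xE q2E /density.
  by field; rewrite h1 h2 w0 e0 kapN0 KN0.
have dx (t : R) :
    is_derive t (1 : R) x (x t * ((B + x t) * (D + x t) * q t ^+ 2 / K)).
  by rewrite /x; deriv_eq.
have dq (t : R) : is_derive t (1 : R) q
    (q t * (1 - reduced_rate (x t) * q t ^+ 2)).
  rewrite {1}/q /lq; deriv_eq; [exact: Bx0 | exact: Dx0 |].
  rewrite -/(lq t) -/(q t) /reduced_rate; field.
  by rewrite KN0 !gt_eqF.
have x_cvg : x t @[t --> -oo] --> 0.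
  have -> : 0 = root 0 by rewrite /root maxxx powR0// invr_neq0.
  under eq_fun do rewrite -xE.
  apply: (@cvg_comp _ _ _ eta root _ _ _ eta_cvg).
  by apply: continuous_max0_powR; rewrite invr_gt0.
exists x, q; split => //.
- have /is_derive1_caratheodory[g [gE g_cont g0]] := dPhi 0.
  have eN0 t : eta t != 0 by rewrite gt_eqF.
  have gE' t : g (eta t) = expR (2 * t) / eta t.
    by have := gE (eta t); rewrite Phi0 !subr0 PhiE => ->; rewrite mulfK.
  have -> : (fun t => q t ^+ 2) = (fun t => 2 * K / kap * g (eta t) * weight (x t)).
    by apply/funext => t; rewrite q2E gE' mulrA [RHS]mulrAC.
  have root0 : root 0 = 0 by rewrite /root maxxx powR0// invr_neq0.
  have -> : 2 * K / (kap * (B * D)) = 2 * K / kap * g 0 * weight 0.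
    have w0 : weight 0 != 0 by rewrite gt_eqF ?expR_gt0.
    rewrite g0 root0 /density !addr0; field.
    by rewrite w0 kapN0 !gt_eqF.
  apply: cvgM; first apply: cvgM; first exact: cvg_cst.
    exact: (@cvg_comp _ _ _ eta g _ _ _ eta_cvg g_cont).
  exact: (@cvg_comp _ _ _ x weight _ _ _ x_cvg (continuous_weight (lexx 0))).
move=> x1 q1 flow1 pos1 x1_cvg.
have x10 t : 0 < x1 t by case: (pos1 t).
have q10 t : 0 < q1 t by case: (pos1 t).
have Bx10 t : 0 < B + x1 t by rewrite addr_gt0.
have Dx10 t : 0 < D + x1 t by rewrite addr_gt0.
have dx1 (t : R) :
    is_derive t (1 : R) x1 (x1 t * ((B + x1 t) * (D + x1 t) * q1 t ^+ 2 / K)).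
  by case: (flow1 t).
have dq1 (t : R) : is_derive t (1 : R) q1
    (q1 t * (1 - reduced_rate (x1 t) * q1 t ^+ 2)).
  by case: (flow1 t).
(* the first integral *)
pose J t := ln (q1 t) - t - a * ln (B + x1 t) - b * ln (D + x1 t)
  + kap / 2 * ln (x1 t).
have dJ (t : R) : is_derive t (1 : R) J 0.
  rewrite /J; deriv_eq; try by [].
  rewrite /reduced_rate; field.
  by rewrite KN0 !gt_eqF.
have JE t : ln (q1 t) =
    J 0 + t + a * ln (B + x1 t) + b * ln (D + x1 t) - kap / 2 * ln (x1 t).
  by rewrite -(is_derive_0_is_cst t 0 dJ) /J; ring.
pose s := J 0 - j.
pose eta1 t := expR (kap * ln (x1 t)).
have eta10 t : 0 < eta1 t by exact: expR_gt0.
have ln_eta1 t : ln (eta1 t) / kap = ln (x1 t) by rewrite /eta1 expRK mulrC mulKf.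
have root_eta1 t : root (eta1 t) = x1 t by rewrite root_gt0E// ln_eta1 lnK ?posrE.
have q12E t : q1 t ^+ 2 =
    2 * K / kap * expR (2 * (t + s)) * weight (x1 t) / eta1 t.
  rewrite -{1}[q1 t]lnK ?posrE// JE -jE /weight /eta1 -expRN -!expRD -expRM_natl.
  by congr expR; rewrite /s; field.
have dPe (t : R) : is_derive t (1 : R)
    (fun t => Phi (eta1 t) - expR (2 * (t + s))) 0.
  have de : is_derive t (1 : R) eta1 
    (eta1 t * (kap * ((B + x1 t) * (D + x1 t) * q1 t ^+ 2 / K))).
    rewrite /eta1; deriv_eq; first exact: x10.
    by field; rewrite KN0 gt_eqF.
  have := @is_derive1_comp R Phi eta1 t _ _ (dPhi (eta1 t)) de.
  rewrite -[_ \o _]/(fun t => Phi (eta1 t)) => h.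
  deriv_eq; rewrite root_eta1 q12E /density.
  have w0 : weight (x1 t) != 0 by rewrite gt_eqF ?expR_gt0.
  by field; rewrite w0 kapN0 KN0 !gt_eqF.
have eta1_cvg : eta1 t @[t --> -oo] --> (0 : R).
  have -> : eta1 = fun t => Num.max (x1 t) 0 `^ kap.
    apply/funext => t; rewrite (max_idPl (ltW (x10 t))) /powR gt_eqF//.
  have := continuous_max0_powR kap0 (x := 0).
  rewrite /continuous_at maxxx powR0// => h.
  exact: (@cvg_comp _ _ _ x1 (fun x => Num.max x 0 `^ kap) _ _ _ x1_cvg h).
have Pe_cvg : Phi (eta1 t) - expR (2 * (t + s)) @[t --> -oo] --> 0.
  rewrite -[X in _ --> X](subrr 0); apply: cvgB.
    rewrite -Phi0; apply: (@cvg_comp _ _ _ eta1 Phi _ (nbhs (0 : R))) => //.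
    by apply: derivable_continuous; case: (dPhi 0).
  apply/cvgNy_compNP.
  have := expR_decay_cvg0 (expR (2 * s)) (ltr0n R 2).
  apply: cvg_trans; apply: near_eq_cvg; near=> t; rewrite /= -expRD.
  by congr expR; ring.
have Phi1E t : Phi (eta1 t) = Phi (eta (t + s)).
  rewrite PhiE; apply/eqP; rewrite -subr_eq0; apply/eqP.
  have cE : (fun t => Phi (eta1 t) - expR (2 * (t + s))) =
      cst (Phi (eta1 t) - expR (2 * (t + s))).
    by apply/funext => u; exact: (is_derive_0_is_cst u t dPe).
  move: Pe_cvg; rewrite cE => h.
  by have := cvg_lim (@Rhausdorff R) h; rewrite lim_cst; [apply | exact: Rhausdorff].
have xE1 t : x1 t = x (t + s).
  by rewrite -root_eta1 (Phi_inj _ _ (Phi1E t)) xE.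
exists s => t; split=> //; rewrite -[LHS]lnK ?posrE// JE; congr expR.
rewrite /lq -!xE1 /L -(Phi_inj _ _ (Phi1E t)) ln_eta1 /s; ring.
Unshelve. all: by end_near. Qed.

End ReducedSystem.

(** * The planar system *)

Section PlanarSystem.
Variable R : realType.
Implicit Types (m n p q : R).

(** If p = u - v, q = w - u and u + m v + n w = 0 then u is [mid m n p q], and
    [rateP] and [rateQ] are 1 - (u^2 + u v + v^2) and 1 - (u^2 + u w + w^2). *)
Definition mid m n p q : R := (m * p - n * q) / (1 + m + n).
Definition rateP m n p q : R :=
  1 - (3 * mid m n p q ^+ 2 - 3 * mid m n p q * p + p ^+ 2).
Definition rateQ m n p q : R :=
  1 - (3 * mid m n p q ^+ 2 + 3 * mid m n p q * q + q ^+ 2).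
(** The line [ell = 0] is u + v + w = 0: it contains the stationary points with
    three different coordinate values, which are the roots of s^3 - s - lam. *)
Definition ell m n p q : R := (2 * m - n - 1) * p - (2 * n - m - 1) * q.

Definition planar_flow m n (p q : R -> R) :=
  forall t : R, is_derive t (1 : R) p (p t * rateP m n (p t) (q t)) /\
                is_derive t (1 : R) q (q t * rateQ m n (p t) (q t)).

(** Changing the sign of all coordinates exchanges the sites of v and w. *)
Lemma mid_swap m n p q : mid n m q p = - mid m n p q.
Proof. by rewrite /mid [1 + n + m]addrAC; ring. Qed.

Lemma rateP_swap m n p q : rateP n m q p = rateQ m n p q.
Proof. by rewrite /rateP /rateQ mid_swap; ring. Qed.

Lemma rateQ_swap m n p q : rateQ n m q p = rateP m n p q.
Proof. by rewrite /rateP /rateQ mid_swap; ring. Qed.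

Lemma ell_swap m n p q : ell n m q p = - ell m n p q.
Proof. by rewrite /ell; ring. Qed.

Lemma planar_flow_swap m n (p q : R -> R) :
  planar_flow m n p q -> planar_flow n m q p.
Proof. by move=> f t; rewrite (rateP_swap m n) (rateQ_swap m n); have [fp fq] := f t; split. Qed.

Lemma planar_flow_shift m n (p q : R -> R) s :
  planar_flow m n p q -> planar_flow m n (fun t => p (t + s)) (fun t => q (t + s)).
Proof. by move=> f t; have [dp dq] := f (t + s); split; exact: deriv_shift. Qed.

Lemma rate_sub m n p q : 1 + m + n != 0 ->
  rateP m n p q - rateQ m n p q = (p + q) * ell m n p q / (1 + m + n).
Proof. by move=> N0; rewrite /rateP /rateQ /mid /ell; field. Qed.

(** The line [ell = 0] is invariant; this is the growth rate of [ell]. *)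
Definition rateL m n p q : R :=
  rateQ m n p q + (2 * m - n - 1) * p * (p + q) / (1 + m + n).

Section Flow.
Variables (m n : R) (p q : R -> R).
Hypothesis flow : planar_flow m n p q.

Let dp (t : R) : is_derive t (1 : R) p (p t * rateP m n (p t) (q t)).
Proof. by case: (flow t). Qed.
Let dq (t : R) : is_derive t (1 : R) q (q t * rateQ m n (p t) (q t)).
Proof. by case: (flow t). Qed.

Lemma derivable_rateP (t : R) : derivable (fun t => rateP m n (p t) (q t)) t 1.
Proof. by rewrite /rateP /mid; derivable. Qed.

Lemma derivable_rateQ (t : R) : derivable (fun t => rateQ m n (p t) (q t)) t 1.
Proof. by rewrite /rateQ /mid; derivable. Qed.

Lemma derivable_rateL (t : R) : derivable (fun t => rateL m n (p t) (q t)) t 1.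
Proof. by rewrite /rateL /rateQ /mid; derivable. Qed.

Lemma deriv_ell (t : R) : 1 + m + n != 0 ->
  is_derive t (1 : R) (fun t => ell m n (p t) (q t))
    (ell m n (p t) (q t) * rateL m n (p t) (q t)).
Proof.
move=> N0; rewrite {1}/ell; deriv_eq.
by rewrite /ell /rateL /rateP /rateQ /mid; field.
Qed.

Lemma flow_p_gt0 s t : 0 < p s -> 0 < p t.
Proof. exact: (linear_ode_gt0 t dp derivable_rateP). Qed.

Lemma flow_q_gt0 s t : 0 < q s -> 0 < q t.
Proof. exact: (linear_ode_gt0 t dq derivable_rateQ). Qed.

Lemma flow_ell_gt0 s t : 1 + m + n != 0 ->
  0 < ell m n (p s) (q s) -> 0 < ell m n (p t) (q t).
Proof.
move=> N0.
exact: (linear_ode_gt0 t (fun t => deriv_ell t N0) derivable_rateL).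
Qed.

Lemma flow_ell_eq0 s t : 1 + m + n != 0 ->
  ell m n (p s) (q s) = 0 -> ell m n (p t) (q t) = 0.
Proof.
move=> N0.
exact: (linear_ode_eq0 t (fun t => deriv_ell t N0) derivable_rateL).
Qed.

End Flow.

(** The ratio e = q / p satisfies e' = - e r with r at least a positive constant,
    because A - B e is positive and nondecreasing and h = 1 / p^2 is bounded; and
    h' = 2 b - 2 h, where b is a polynomial in e.  So e tends to 0, and then h to
    the value of b at e = 0. *)
Lemma planar_forward m n (p q : R -> R) (P : R) :
  0 <= m -> 0 <= n -> 0 < 2 * m - n - 1 -> 0 < 2 * n - m - 1 ->
  planar_flow m n p q -> 0 < p 0 -> 0 < q 0 -> 0 < ell m n (p 0) (q 0) ->
  0 < P -> rateP m n P 0 = 0 ->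
  p t @[t --> +oo] --> P /\ q t @[t --> +oo] --> 0.
Proof.
move=> m0 n0; set A := 2 * m - n - 1; set B := 2 * n - m - 1 => A0 B0.
move=> flow p0 q0 l0 P0 rP; set N := 1 + m + n.
have N0 : 0 < N by rewrite /N; lra.
have NN0 : N != 0 by rewrite gt_eqF.
have pt t : 0 < p t by exact: (flow_p_gt0 flow t p0).
have qt t : 0 < q t by exact: (flow_q_gt0 flow t q0).
have lt t : 0 < ell m n (p t) (q t) by exact: (flow_ell_gt0 flow t NN0 l0).
have dp (t : R) : is_derive t (1 : R) p (p t * rateP m n (p t) (q t)).
  by case: (flow t).
have dq (t : R) : is_derive t (1 : R) q (q t * rateQ m n (p t) (q t)).
  by case: (flow t).
pose e t := q t / p t; pose h t := (p t ^+ 2)^-1.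
have et t : 0 < e t by rewrite divr_gt0.
have ht t : 0 < h t by rewrite invr_gt0 exprn_gt0.
pose r t := (1 + e t) * (A - B * e t) / (N * h t).
pose w t := (m - n * e t) / N.
pose b t := 3 * w t ^+ 2 - 3 * w t + 1.
have pN0 t : p t != 0 by rewrite gt_eqF.
have de (t : R) : is_derive t (1 : R) e (- (e t * r t)).
  rewrite /e; deriv_eq; first exact: pN0.
  rewrite -[q t * _]opprK -mulNr.
  have -> : r t = rateP m n (p t) (q t) - rateQ m n (p t) (q t).
    by rewrite rate_sub// /r /ell -/A -/B -/N /e /h; field; rewrite NN0 pN0.
  by rewrite /e; field; rewrite pN0.
have dh (t : R) : is_derive t (1 : R) h (2 * b t - 2 * h t).
  rewrite /h; deriv_eq; first by rewrite expf_neq0.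
  by rewrite /h /b /w /rateP /mid /e -/N; field; rewrite NN0 pN0.
have ABe t : 0 < A - B * e t.
  have -> : A - B * e t = ell m n (p t) (q t) / p t.
    by rewrite /ell /e -/A -/B; field; rewrite pN0.
  exact: divr_gt0.
have e_le (t : R) : 0 <= t -> e t <= e 0.
  move=> t0; rewrite -lerN2.
  apply: (@deriv_ge0_le _ (fun t => - e t) (fun t => e t * r t)) => //.
    by move=> u; deriv_eq; ring.
  move=> u _; rewrite mulr_ge0 ?(ltW (et u))// divr_ge0 ?mulr_ge0 ?(ltW (ABe u))//.
  - by rewrite addr_ge0// ltW.
  - exact: ltW.
  - exact: ltW.
pose S := (m + n * e 0) / N.
pose C := 3 * S ^+ 2 + 3 * S + 1.
have S0 : 0 <= S by rewrite divr_ge0 ?(ltW N0)// addr_ge0// mulr_ge0 ?(ltW (et 0)).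
have C0 : 0 < C.
  have := sqr_ge0 S; rewrite /C; lra.
have b_le (t : R) : 0 <= t -> b t <= C.
  move=> t0; have [w1 w2] : w t <= S /\ - w t <= S.
    rewrite /w /S -[- (_ / N)]mulNr !ler_pM2r ?invr_gt0//.
    have h1 := ltW (et t); have h2 := ltW (et 0).
    have h3 := e_le t t0; have : n * e t <= n * e 0 by rewrite ler_wpM2l.
    have : 0 <= n * e t by rewrite mulr_ge0.
    have : 0 <= n * e 0 by rewrite mulr_ge0.
    by split; lra.
  have : w t ^+ 2 <= S ^+ 2.
    by rewrite -[w t ^+ 2]real_normK ?num_real// ler_sqr ?nnegrE// ler_norml lerNl w2 w1.
  by rewrite /b /C; lra.
have h_le (t : R) : 0 <= t -> h t <= C + h 0.
  move=> t0; apply: (le_trans (relaxation_ode_le dh b_le t0)).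
  have E1 : expR (2 * (0 - t)) <= 1.
    by rewrite -[leRHS]expR0 ler_expR; lra.
  have E0 : 0 < expR (2 * (0 - t)) by exact: expR_gt0.
  rewrite lerD2l; apply: (@le_trans _ _ (expR (2 * (0 - t)) * h 0)).
    by rewrite ler_pM2l// gerBl ltW.
  by rewrite ger_pMl.
have e_cvg : e t @[t --> +oo] --> 0.
  apply: (decay_ode_cvg0 (m := (A - B * e 0) / (N * (C + h 0))) de).
  - by move=> t; exact: ltW.
  - by rewrite divr_gt0// mulr_gt0// addr_gt0.
  move=> t t0; rewrite /r -[leLHS]mul1r -mulrA.
  apply: ler_pM => //.
  - by rewrite divr_ge0 ?(ltW (ABe _))// mulr_ge0 ?(ltW N0)// addr_ge0// ltW.
  - by rewrite lerDl ltW.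
  apply: ler_pM; rewrite ?(ltW (ABe _))//.
  - by rewrite invr_ge0 mulr_ge0 ?(ltW N0)// addr_ge0// ltW.
  - by rewrite lerD2l lerN2 ler_pM2l// e_le.
  have NC : 0 < N * (C + h 0) by apply: mulr_gt0 => //; exact: addr_gt0.
  have Nh : 0 < N * h t by exact: mulr_gt0.
  by rewrite lef_pV2 ?posrE// ler_pM2l// h_le.
have w_cvg : w t @[t --> +oo] --> m / N.
  have -> : m / N = (m - n * 0) / N by rewrite mulr0 subr0.
  apply: cvgM; last exact: cvg_cst.
  by apply: cvgB; [exact: cvg_cst | apply: cvgM => //; exact: cvg_cst].
have b_cvg : b t @[t --> +oo] --> (P ^+ 2)^-1.
  have -> : (P ^+ 2)^-1 = 3 * (m / N) ^+ 2 - 3 * (m / N) + 1.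
    have PN0 : P != 0 by rewrite gt_eqF.
    apply: (mulIf (expf_neq0 2 PN0)); rewrite mulVf ?expf_neq0//.
    apply/eqP; rewrite -subr_eq0; apply/eqP; rewrite -[RHS]rP /rateP /mid -/N.
    by field; rewrite NN0.
  apply: cvgD; last exact: cvg_cst.
  apply: cvgB; first by apply: cvgM; [exact: cvg_cst | exact: cvg_sqr].
  by apply: cvgM => //; exact: cvg_cst.
have h_cvg := relaxation_ode_cvg dh b_cvg.
have p_cvg : p t @[t --> +oo] --> P.
  have hV : (h t)^-1 @[t --> +oo] --> (P ^+ 2)^-1^-1.
    by apply: cvgV => //; rewrite gt_eqF// invr_gt0 exprn_gt0.
  have -> : P = Num.sqrt (P ^+ 2)^-1^-1 by rewrite invrK sqrtr_sqr gtr0_norm.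
  have -> : p = fun t => Num.sqrt (h t)^-1.
    by apply/funext => t; rewrite /h invrK sqrtr_sqr gtr0_norm.
  apply: (@cvg_comp _ _ _ (fun t => (h t)^-1) Num.sqrt _ _ _ hV).
  exact: sqrt_continuous.
split=> //.
have -> : q = fun t => e t * p t by apply/funext => t; rewrite /e divfK.
by rewrite -[X in _ --> X](mul0r P); exact: (cvgM e_cvg p_cvg).
Qed.

Lemma quad_gt0 (w : R) : 0 < 3 * w ^+ 2 + 3 * w + 1.
Proof.
have -> : 3 * w ^+ 2 + 3 * w + 1 = 3 * (w + 1 / 2) ^+ 2 + 1 / 4 by field.
by rewrite ltr_wpDl// mulr_ge0// sqr_ge0.
Qed.

(** On the invariant line q' = q (1 - c q^2), for which Q attracts: the
    difference q - Q cannot tend to 0 backwards in time unless it vanishes. *)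
Lemma planar_center m n (p q : R -> R) (P Q : R) :
  0 <= m -> 0 <= n -> 0 < 2 * m - n - 1 ->
  planar_flow m n p q -> ell m n (p 0) (q 0) = 0 ->
  0 < Q -> ell m n P Q = 0 -> rateQ m n P Q = 0 ->
  q t @[t --> -oo] --> Q -> forall t, p t = P /\ q t = Q.
Proof.
move=> m0 n0; set A := 2 * m - n - 1 => A0 flow l0 Q0 lPQ rPQ qQ.
set N := 1 + m + n; have NN0 : N != 0 by rewrite gt_eqF// /N; lra.
have AN0 : A != 0 by rewrite gt_eqF.
pose B := 2 * n - m - 1; pose w := (m * (B / A) - n) / N.
pose c := 3 * w ^+ 2 + 3 * w + 1.
have pE (p' q' : R) : ell m n p' q' = 0 -> p' = B / A * q'.
  rewrite /ell -/A -/B => /eqP; rewrite subr_eq0 => /eqP e.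
  by apply: (mulfI AN0); rewrite e; field; rewrite AN0.
have rE (p' q' : R) : ell m n p' q' = 0 -> rateQ m n p' q' = 1 - c * q' ^+ 2.
  by move=> /pE ->; rewrite /rateQ /mid -/N /c /w; field; rewrite AN0 NN0.
have lt t : ell m n (p t) (q t) = 0 by exact: (flow_ell_eq0 flow t NN0 l0).
have dq (t : R) : is_derive t (1 : R) q (q t * rateQ m n (p t) (q t)).
  by case: (flow t).
have cQ : c * Q ^+ 2 = 1 by have := rE _ _ lPQ; rewrite rPQ; lra.
have dd (t : R) : is_derive t (1 : R) (fun t => q t - Q)
    ((q t - Q) * - (c * q t * (q t + Q))).
  by deriv_eq; rewrite (rE _ _ (lt t)); ring: cQ.
have da (t : R) : derivable (fun t => - (c * q t * (q t + Q))) t 1.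
  by derivable.
have a_le0 : \forall t \near -oo, - (c * q t * (q t + Q)) <= 0.
  near=> u; have qu : 0 < q u by near: u; exact: (cvgr_gt _ qQ).
  rewrite oppr_le0 mulr_ge0 ?addr_ge0 ?(ltW qu) ?(ltW Q0)//.
  by rewrite mulr_ge0 ?(ltW qu)// ltW// quad_gt0.
have d0 : q t - Q @[t --> -oo] --> 0.
  by rewrite -[X in _ --> X](subrr Q); apply: cvgB => //; exact: cvg_cst.
have qE t : q t = Q.
  by apply/eqP; rewrite -subr_eq0 (linear_ode_back_eq0 dd da a_le0 d0).
by move=> t; rewrite qE (pE _ _ (lt t)) (pE _ _ lPQ) qE.
Unshelve. all: by end_near. Qed.

(** With x = ell / q the planar system is a reduced system, for the a, b and kap
    that express the polynomial c, which is quadratic in x, in the basis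
    (B + x) (D + x), x (D + x), x (B + x); they are read off at the points
    x = 0, - B and - D.  The bound [hab], which makes the orbit defined at all
    times, holds because 3 m^2 - N A is a sum of two squares. *)
Lemma planar_unstable m n (P Q : R) :
  0 <= m -> 0 <= n -> 0 < 2 * m - n - 1 -> 0 < 2 * n - m - 1 ->
  0 < Q -> ell m n P Q = 0 -> rateQ m n P Q = 0 ->
  exists p q : R -> R,
    [/\ planar_flow m n p q,
        forall t, [/\ 0 < p t, 0 < q t & 0 < ell m n (p t) (q t)],
        p t @[t --> -oo] --> P /\ q t @[t --> -oo] --> Q &
        forall p1 q1 : R -> R, planar_flow m n p1 q1 ->
          (forall t, [/\ 0 < p1 t, 0 < q1 t & 0 < ell m n (p1 t) (q1 t)]) ->
          p1 t @[t --> -oo] --> P -> q1 t @[t --> -oo] --> Q ->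
          exists s, forall t, p1 t = p (t + s) /\ q1 t = q (t + s)].
Proof.
move=> m0 n0; set A := 2 * m - n - 1; set B := 2 * n - m - 1 => A0 B0 Q0 lPQ rPQ.
set N := 1 + m + n; have N0 : 0 < N by rewrite /N; lra.
have NN0 : N != 0 by rewrite gt_eqF.
have AN0 : A != 0 by rewrite gt_eqF.
have BN0 : B != 0 by rewrite gt_eqF.
have QN0 : Q != 0 by rewrite gt_eqF.
pose D := A + B; have D0 : 0 < D by exact: addr_gt0.
have DN0 : D != 0 by rewrite gt_eqF.
have BD : B <= D by rewrite lerDr ltW.
pose w x := (m * ((B + x) / A) - n) / N.
pose c x := 3 * w x ^+ 2 + 3 * w x + 1.
have c0 x : 0 < c x by exact: quad_gt0.
pose K := N * A; have K0 : 0 < K by exact: mulr_gt0.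
pose kap := 2 * K * c 0 / (B * D).
have kap0 : 0 < kap by rewrite divr_gt0 ?mulr_gt0.
pose a := N * c (- B) / B; pose b := - (N * c (- D) / D).
have rateE x : reduced_rate a b kap K B D x = c x.
  rewrite /reduced_rate /a /b /kap /K /c /w /D; field.
  by rewrite NN0 AN0 BN0 DN0.
have hb : 1 + 2 * b <= 0.
  have DE : D = N - 3 by rewrite /D /A /B /N; ring.
  have -> : 1 + 2 * b = - ((N - 3 / 2) ^+ 2 + 15 / 4) / (N * D).
    rewrite /b /c /w; have -> : (B + - D) / A = -1.
      by rewrite /D opprD addrCA subrr addr0 mulNr mulfV.
    have -> : (m * -1 - n) / N = - (N - 1) / N by rewrite /N; congr (_ / _); ring.
    by move: DN0; rewrite DE => DN0; field; rewrite NN0 DN0.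
  rewrite mulNr oppr_le0 divr_ge0 ?mulr_ge0 ?(ltW N0) ?(ltW D0)//.
  by rewrite addr_ge0// sqr_ge0.
have hab : 2 + 2 * a + 2 * b <= kap.
  rewrite -subr_ge0.
  have -> : kap - (2 + 2 * a + 2 * b) = 2 * (3 * m ^+ 2 - N * A) / (N * A).
    rewrite /a /b /kap /K /c /w /D; field.
    by rewrite NN0 AN0 BN0 DN0.
  rewrite divr_ge0 ?mulr_ge0 ?(ltW N0) ?(ltW A0)//.
  have -> : 3 * m ^+ 2 - N * A = (m - (n + 1) / 2) ^+ 2 + 3 / 4 * (n + 1) ^+ 2.
    by rewrite /N /A; field.
  by rewrite addr_ge0 ?sqr_ge0// mulr_ge0// sqr_ge0.
have rQE x q : rateQ m n ((B + x) * q / A) q = 1 - c x * q ^+ 2.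
  by rewrite /rateQ /mid -/N /c /w; field; rewrite AN0 NN0.
have ellE x q : ell m n ((B + x) * q / A) q = x * q.
  by rewrite /ell -/A -/B; field.
have rPE x q : rateP m n ((B + x) * q / A) q =
    1 - c x * q ^+ 2 + x * (D + x) * q ^+ 2 / K.
  have := rate_sub ((B + x) * q / A) q NN0.
  rewrite rQE ellE -/N => /eqP; rewrite subr_eq => /eqP ->.
  by rewrite addrC; congr (_ + _); rewrite /K /D; field; rewrite NN0 AN0.
have PE : P = (B + 0) * Q / A.
  apply: (mulfI AN0); move: lPQ; rewrite /ell -/A -/B => /eqP.
  by rewrite subr_eq0 => /eqP ->; field.
have cQ : c 0 * Q ^+ 2 = 1.
  by move: rPQ; rewrite PE rQE => /eqP; rewrite subr_eq0 eq_sym => /eqP.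
have [x [q [flow pos x_cvg q_cvg uniq]]] := reduced_unstable kap0 K0 B0 BD hb hab.
have dx (t : R) :
    is_derive t (1 : R) x (x t * ((B + x t) * (D + x t) * q t ^+ 2 / K)).
  by case: (flow t).
have dq (t : R) : is_derive t (1 : R) q (q t * (1 - c (x t) * q t ^+ 2)).
  by rewrite -rateE; case: (flow t).
have x0 t : 0 < x t by case: (pos t).
have q0 t : 0 < q t by case: (pos t).
have KN0 : K != 0 by rewrite gt_eqF.
have qQ : q t @[t --> -oo] --> Q.
  have -> : Q = Num.sqrt (Q ^+ 2) by rewrite sqrtr_sqr gtr0_norm.
  have -> : q = fun t => Num.sqrt (q t ^+ 2).
    by apply/funext => t; rewrite sqrtr_sqr gtr0_norm.
  have h : q t ^+ 2 @[t --> -oo] --> Q ^+ 2.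
    have <- : 2 * K / (kap * (B * D)) = Q ^+ 2; last exact: q_cvg.
    have c0N0 : c 0 != 0 by rewrite gt_eqF.
    apply: (mulfI c0N0); rewrite cQ /kap; field.
    by rewrite c0N0 BN0 DN0 KN0.
  apply: (@cvg_comp _ _ _ (fun t => q t ^+ 2) Num.sqrt _ _ _ h).
  exact: sqrt_continuous.
exists (fun t => (B + x t) * q t / A), q; split.
- move=> t; rewrite rPE rQE; split; last exact: dq.
  deriv_eq; rewrite /K /D; field.
  by rewrite AN0 NN0.
- move=> t; rewrite ellE; split => //; last exact: mulr_gt0.
  by rewrite divr_gt0 ?mulr_gt0// addr_gt0.
- split=> //; rewrite PE; apply: cvgM; last exact: cvg_cst.
  by apply: cvgM => //; apply: cvgD => //; exact: cvg_cst.
move=> p1 q1 flow1 pos1 p1P q1Q.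
pose x1 t := ell m n (p1 t) (q1 t) / q1 t.
have q10 t : 0 < q1 t by case: (pos1 t).
have q1N0 t : q1 t != 0 by rewrite gt_eqF.
have p1E t : p1 t = (B + x1 t) * q1 t / A.
  by rewrite /x1 /ell -/A -/B; field; rewrite AN0 q1N0.
have x10 t : 0 < x1 t by rewrite divr_gt0//; case: (pos1 t).
have [|||s sE] := uniq x1 q1.
- move=> t; have [dp1 dq1] := flow1 t.
  have dl1 := deriv_ell flow1 t NN0.
  split; last by move: dq1; rewrite p1E rQE rateE.
  rewrite /x1; deriv_eq; first exact: q1N0.
  rewrite /rateL -/A -/N {1 2 4}p1E !ellE.
  by rewrite p1E ellE /K /D; field; rewrite AN0 NN0 q1N0.
- by move=> t; split.
- rewrite -[X in _ --> X](mul0r Q^-1); apply: cvgM; last exact: cvgV.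
  rewrite -lPQ; apply: cvgB; apply: cvgM => //; exact: cvg_cst.
exists s => t; have [xs qs] := sE t.
by split=> //; rewrite p1E xs qs.
Qed.

End PlanarSystem.

(** * Local minima with two coordinate values *)

Lemma char_poly_conj (F : fieldType) n (P A : 'M[F]_n) : P \in unitmx ->
  char_poly (conjmx (invmx P) A) = char_poly A.
Proof.
move=> Pu; rewrite conjVmx// /char_poly.
have -> : char_poly_mx (invmx P *m A *m P) =
    map_mx polyC (invmx P) *m char_poly_mx A *m map_mx polyC P.
  rewrite /char_poly_mx mulmxBr mulmxBl -!map_mxM; congr (_ - _).
  by rewrite scalar_mxC -mulmxA -map_mxM mulVmx// map_mx1 mulmx1.
rewrite !det_mulmx mulrC mulrA -det_mulmx -map_mxM mulmxV//.
by rewrite map_mx1 det1 mul1r.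
Qed.

(** A polynomial with distinct roots that annihilates the restriction of f to the
    row space of V makes this restriction diagonalizable. *)
Lemma char_poly_conj_roots (F : fieldType) r n (V : 'M[F]_(r, n.+1))
    (f : 'M[F]_n.+1) (rs : seq F) :
  row_free V -> stablemx V f -> uniq rs ->
  V *m horner_mx f (\prod_(a <- rs) ('X - a%:P)) = 0 ->
  exists s : seq F, char_poly (conjmx V f) = \prod_(a <- s) ('X - a%:P) /\
    {subset s <= rs}.
Proof.
case: r V => [|r] V rfV stV urs V0.
  by exists [::]; split=> //; rewrite big_nil /char_poly det_mx00.
have hA : horner_mx (conjmx V f) (\prod_(a <- rs) ('X - a%:P)) = 0.
  by rewrite horner_mx_conj// /conjmx V0 mul0mx.
have [P Pu /diagonalizable_forPex[d /(simmxLR Pu) AE]] :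
    diagonalizable (conjmx V f).
  by apply/diagonalizableP; exists rs => //; apply: mxminpoly_min.
have cE : char_poly (conjmx V f) =
    \prod_(a <- [seq d 0 i | i <- enum 'I_r.+1]) ('X - a%:P).
  rewrite AE char_poly_conj// char_poly_trig ?diag_mx_is_trig// big_image/=.
  by apply: eq_bigr => i _; rewrite mxE eqxx.
eexists; split; first exact: cE.
move=> a aS.
have dvd : mxminpoly (conjmx V f) %| \prod_(a <- rs) ('X - a%:P).
  exact: mxminpoly_min.
rewrite -root_prod_XsubC; apply: (root_dvdp dvd).
by rewrite root_mxminpoly cE root_prod_XsubC.
Qed.

Section TwoValued.
Variables (R : realType) (n : nat).
Local Notation N := n.+1.

Lemma sum_if (c : pred 'I_N) (a b : R) :
  \sum_i (if c i then a else b) = #|c|%:R * a + (N%:R - #|c|%:R) * b.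
Proof.
rewrite (bigID c)/= (eq_bigr (fun=> a)); last by move=> i ->.
rewrite [X in _ + X](eq_bigr (fun=> b)); last by move=> i /negPf ->.
rewrite !sumr_const -[a *+ _]mulr_natl -[b *+ _]mulr_natl; congr (_ * _ + _ * _).
have := cardC c; rewrite card_ord => /(congr1 (fun k => k%:R : R)).
by rewrite natrD => <-; rewrite addrC addKr.
Qed.

Lemma mulmx_diag_proj (w d : 'rV[R]_N) (e : R) i :
  (w *m (diag_mx d *m projS R N - e%:M)) ord0 i =
  w ord0 i * (d ord0 i - e) - N%:R^-1 * \sum_j w ord0 j * d ord0 j.
Proof.
rewrite mulmxBr mul_mx_scalar mulmxA mul_mx_diag /projS mulmxBr mulmx1.
rewrite -scalemxAr !mxE.
under eq_bigr do rewrite !mxE mulr1.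
by rewrite /=; ring.
Qed.

Lemma mulmx_diag_proj_const (d : 'rV[R]_N) (e : R) (w : 'rV[R]_N) :
  zero_sum w -> (forall i, d ord0 i = e) ->
  w *m (diag_mx d *m projS R N - e%:M) = 0.
Proof.
move=> w0 de; apply/rowP => i; rewrite mulmx_diag_proj mxE de subrr mulr0.
rewrite (eq_bigr (fun j => w ord0 j * e)) => [|j _]; last by rewrite de.
by rewrite -mulr_suml w0 mul0r mulr0 subrr.
Qed.

(** For w of sum 0 the vector w (T - d2) is, up to a constant vector, supported
    on the class c, and applying T - d1 then gives a multiple of the vector with
    constant value on c and on its complement, and with sum 0.  The latter is an
    eigenvector, of eigenvalue d3. *)
Lemma mulmx_diag_proj_two (d : 'rV[R]_N) (c : pred 'I_N) (d1 d2 : R)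
    (w : 'rV[R]_N) (a := #|c|%:R) (b := N%:R - #|c|%:R)
    (d3 := (b * d1 + a * d2) / N%:R) :
  zero_sum w -> (forall i, d ord0 i = if c i then d1 else d2) ->
  w *m (diag_mx d *m projS R N - d2%:M) *m (diag_mx d *m projS R N - d1%:M)
    *m (diag_mx d *m projS R N - d3%:M) = 0.
Proof.
move=> w0 dE; pose s := \sum_(i | c i) w ord0 i.
have N0 : N%:R != 0 :> R by rewrite pnatr_eq0.
have sumw (x y : R) : \sum_i w ord0 i * (if c i then x else y) = s * x - s * y.
  rewrite (bigID c)/= (eq_bigr (fun i => w ord0 i * x)) => [|i ->//].
  rewrite [X in _ + X](eq_bigr (fun i => w ord0 i * y)) => [|i /negPf->//].
  rewrite -!mulr_suml -/s.
  have -> : \sum_(i | ~~ c i) w ord0 i = - s; last by rewrite mulNr.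
  have : \sum_i w ord0 i = 0 by exact: w0.
  by rewrite (bigID c)/= -/s => /eqP; rewrite addrC addr_eq0 => /eqP.
have bE : b = N%:R - a by [].
set T := diag_mx d *m projS R N.
set w1 := w *m (T - d2%:M).
have w1E i : w1 ord0 i =
    w ord0 i * (if c i then d1 - d2 else 0) - N%:R^-1 * (s * (d1 - d2)).
  rewrite /w1 mulmx_diag_proj dE; under eq_bigr do rewrite dE.
  rewrite sumw; congr (_ * _ - _ * _); last by ring.
  by case: ifP; rewrite ?subrr.
set w2 := w1 *m (T - d1%:M).
have w2E i : w2 ord0 i =
    (d1 - d2) ^+ 2 * s / N%:R ^+ 2 * (if c i then - b else a).
  rewrite /w2 mulmx_diag_proj w1E dE.
  have -> : \sum_j w1 ord0 j * d ord0 j =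
      b * (d1 - d2) ^+ 2 * s / N%:R.
    under eq_bigr do rewrite w1E dE mulrBl -mulrA.
    rewrite sumrB (eq_bigr (fun j => w ord0 j *
       (if c j then (d1 - d2) * d1 else 0))) => [|j _]; last first.
      by case: ifP; rewrite ?mul0r.
    rewrite sumw -mulr_sumr sum_if -/a -/b bE; move: (N%:R : R) N0 => Nr N0; field; exact: N0.
  by case: ifP => _; rewrite bE; move: (N%:R : R) N0 => Nr N0; field; exact: N0.
apply/rowP => i; rewrite mulmx_diag_proj w2E dE mxE.
have -> : \sum_j w2 ord0 j * d ord0 j =
    (d1 - d2) ^+ 2 * s / N%:R ^+ 2 * (a * b * (d2 - d1)).
  under eq_bigr do rewrite w2E dE -mulrA.
  rewrite -mulr_sumr; congr (_ * _).
  rewrite (eq_bigr (fun j => if c j then - b * d1 else a * d2)) => [|j _].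
    by rewrite sum_if -/a -/b; ring.
  by case: ifP.
by rewrite /d3 bE; case: ifP => _; move: (N%:R : R) N0 => Nr N0; field; exact: N0.
Qed.

(** The eigenvalues are among d1, d2 and their weighted mean d3.  When one of
    these coincides with another, either d1 = d2 or a class is empty; the
    projected Hessian is then scalar on the hyperplane. *)
Lemma two_valued_index0 (x : 'rV[R]_N) (al1 al2 : R) :
  (forall i, x ord0 i = al1 \/ x ord0 i = al2) ->
  0 < 3 * al1 ^+ 2 - 1 -> 0 < 3 * al2 ^+ 2 - 1 -> has_index x 0.
Proof.
move=> xE; set d1 := _ - 1 => d1_gt0; set d2 := _ - 1 => d2_gt0.
pose c i := x ord0 i == al1.
pose d := \row_i (3 * x ord0 i ^+ 2 - 1).
have dE i : d ord0 i = if c i then d1 else d2.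
  by rewrite mxE /c /d1 /d2; case: eqP => [->//|]; case: (xE i) => ->.
set a : R := #|c|%:R; set b : R := N%:R - #|c|%:R.
set T := diag_mx d *m projS R N.
have stT : stablemx (row_base (projS R N)) T.
  by rewrite stablemx_row_base /T mulmxA submxMl.
have rowS (w : 'rV[R]_N) : (w <= row_base (projS R N))%MS -> zero_sum w.
  by rewrite eq_row_base => ?; apply/zero_sumP.
have key (rs : seq R) : uniq rs -> {in rs, forall e, 0 <= e} ->
    (forall w : 'rV[R]_N, zero_sum w ->
      w *m horner_mx T (\prod_(e <- rs) ('X - e%:P)) = 0) -> has_index x 0.
  move=> urs rs0 rsT.
  have [||s [sE srs]] := char_poly_conj_roots _ stT urs.
  - exact: row_base_free.
  - apply/row_matrixP => i; rewrite row_mul row0; apply/rsT/rowS.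
    exact: row_sub.
  exists s; split.
    by rewrite /hessS hessE; exact: sE.
  rewrite -[RHS](count_pred0 s); apply: eq_in_count => e /srs/rs0/=.
  by rewrite leNgt => /negPf.
have hXC e : horner_mx T ('X - e%:P) = T - e%:M.
  by rewrite rmorphB /= horner_mx_X horner_mx_C.
have cst e : 0 < e -> (forall i, d ord0 i = e) -> has_index x 0.
  move=> e_gt0 de; apply: (key [:: e]) => // [e'|w w0].
    by rewrite inE => /eqP ->; exact: ltW.
  by rewrite big_seq1 hXC mulmx_diag_proj_const.
have [d12|d12] := eqVneq d1 d2.
  by apply: (cst d1) => // i; rewrite dE -d12; case: ifP.
have [a0|a0] := eqVneq #|c| 0%N.
  by apply: (cst d2) => // i; rewrite dE; have ci : c i = false := card0_eq a0 i; rewrite ci.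
have [b0|b0] := eqVneq #|[predC c]| 0%N.
  apply: (cst d1) => // i; rewrite dE.
  by have ci : c i = true := negbFE (card0_eq b0 i); rewrite ci.
have a_gt0 : 0 < a by rewrite ltr0n lt0n.
have b_gt0 : 0 < b.
  by rewrite subr_gt0 ltr_nat -[ltnRHS]card_ord -(cardC c) -ltn_subLR// subnn lt0n.
have N0 : 0 < N%:R :> R by rewrite ltr0n.
pose d3 := (b * d1 + a * d2) / N%:R.
have d3_ge0 : 0 <= d3.
  by rewrite divr_ge0 ?ltW// addr_gt0// mulr_gt0.
have d3E : d3 * N%:R = b * d1 + a * d2 by rewrite divfK// gt_eqF.
have d13 : d1 != d3.
  apply: contraNneq d12 => d13; rewrite -subr_eq0.
  rewrite -(mulrI_eq0 _ (lregP (lt0r_neq0 a_gt0))).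
  have -> : a * (d1 - d2) = d1 * N%:R - (b * d1 + a * d2).
    by rewrite /b -/a; ring.
  by rewrite -d3E -d13 subrr.
have d23 : d2 != d3.
  apply: contraNneq d12 => d23; rewrite -subr_eq0.
  rewrite -(mulrI_eq0 _ (lregP (lt0r_neq0 b_gt0))).
  have -> : b * (d1 - d2) = (b * d1 + a * d2) - d2 * N%:R.
    by rewrite /b -/a; ring.
  by rewrite -d3E -d23 subrr.
apply: (key [:: d2; d1; d3]) => [|e|w w0].
- by rewrite /= !inE negb_or eq_sym d12 d23 d13.
- by rewrite !inE => /or3P[] /eqP ->//; exact: ltW.
rewrite !big_cons big_nil mulr1 !(rmorphM (horner_mx T))/= !hXC.
rewrite -[RHS](mulmx_diag_proj_two w0 dE) -/T -/a -/b -/d3.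
by rewrite -!mulmxA.
Qed.
End TwoValued.

Lemma cvg_sqrD (R : realType) (T : Type) (F : set_system T) {FF : Filter F}
    (u : T -> R) (l c d e : R) : u t @[t --> F] --> l ->
  (u t + c) ^+ 2 + d - e @[t --> F] --> (l + c) ^+ 2 + d - e.
Proof.
move=> ul; have h : u t + c @[t --> F] --> l + c.
  by apply: cvgD => //; exact: cvg_cst.
apply: cvgB; last exact: cvg_cst.
apply: cvgD; last exact: cvg_cst.
by rewrite expr2; under eq_fun do rewrite expr2; exact: cvgM.
Qed.

Lemma cvg_coord (R : realType) (n : nat) (T : Type) (F : set_system T)
    {FF : Filter F} (g : T -> 'rV[R]_n) (l : 'rV[R]_n) i :
  g t @[t --> F] --> l -> g t ord0 i @[t --> F] --> l ord0 i.
Proof. move=> gl; apply: (@cvg_comp _ _ _ g (fun M : 'rV[R]_n => M ord0 i) _ _ _ gl).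
exact: coord_continuous. Qed.

Section TwoValuedMinimum.
Variables (R : realType) (N : nat).
Hypothesis N0 : (0 < N)%N.

(** On the hyperplane V0 y - V0 x is the sum over the sites i of
    F(y_i) - F(x_i) - lam (y_i - x_i) with F(s) = s^4 / 4 - s^2 / 2, and this term
    is (y_i - x_i)^2 / 4 times a factor [Q i y] that is positive for y close
    to x. *)
Lemma local_minimum_two_valued (x : 'rV[R]_N) (al1 al2 : R) :
  zero_sum x -> (forall i, x ord0 i = al1 \/ x ord0 i = al2) ->
  al1 ^+ 2 + al1 * al2 + al2 ^+ 2 = 1 ->
  0 < 3 * al1 ^+ 2 - 1 -> 0 < 3 * al2 ^+ 2 - 1 -> local_minimum x.
Proof.
move=> x0 xE al12 d1_gt0 d2_gt0.
have lamE i : x ord0 i ^+ 3 - x ord0 i = al1 ^+ 3 - al1.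
  case: (xE i) => -> //; apply/eqP; rewrite -subr_eq0.
  have -> : al2 ^+ 3 - al2 - (al1 ^+ 3 - al1) =
    (al2 - al1) * (al1 ^+ 2 + al1 * al2 + al2 ^+ 2 - 1) by ring.
  by rewrite al12 subrr mulr0.
split; first by apply/stationaryP => //; split=> //; exists (al1 ^+ 3 - al1).
  by case: N N0 x xE {x0 lamE} => // n _ x xE; exact: two_valued_index0 xE d1_gt0 d2_gt0.
pose Q i (y : 'rV[R]_N) := (y ord0 i + x ord0 i) ^+ 2 + 2 * x ord0 i ^+ 2 - 2.
have near_i i : \forall y \near x, 0 < Q i y.
  have cvg_i : Q i y @[y --> x] -->
      (x ord0 i + x ord0 i) ^+ 2 + 2 * x ord0 i ^+ 2 - 2.
    have cx : (y : 'rV[R]_N) ord0 i @[y --> x] --> x ord0 i.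
      exact: coord_continuous.
    exact: (@cvg_sqrD R _ _ (nbhs_filter x) (fun y : 'rV[R]_N => y ord0 i) _ _ _ _ cx).
  apply: (cvgr_gt _ cvg_i).
  by case: (xE i) => ->; lra.
have : \forall y \near x, forall i : 'I_N, 0 < Q i y.
  exact: (@filter_forall _ _ _ _ (nbhs_filter x) near_i).
apply: filterS => y hy y0; rewrite -subr_ge0 /V0 -sumrB.
have -> : \sum_(i < N) (y ord0 i ^+ 4 / 4 - y ord0 i ^+ 2 / 2 -
                       (x ord0 i ^+ 4 / 4 - x ord0 i ^+ 2 / 2)) =
    \sum_(i < N) ((y ord0 i - x ord0 i) ^+ 2 / 4 *
      Q i y) +
    (al1 ^+ 3 - al1) * (\sum_(i < N) y ord0 i - \sum_(i < N) x ord0 i).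
  rewrite -sumrB mulr_sumr -big_split/=; apply: eq_bigr => i _.
  by rewrite -(lamE i) /Q; field.
rewrite y0 x0 subrr mulr0 addr0; apply: sumr_ge0 => i _.
by apply: mulr_ge0; [rewrite divr_ge0 ?sqr_ge0 | exact/ltW/hy].
Qed.

Lemma labelled_triple_two_valued (x : 'rV[R]_N) (al1 al2 : R) (a b : nat) :
  al1 != al2 -> (forall i, x ord0 i = al1 \/ x ord0 i = al2) ->
  al1 ^+ 2 + al1 * al2 + al2 ^+ 2 = 1 ->
  0 < 3 * al1 ^+ 2 - 1 -> 0 < 3 * al2 ^+ 2 - 1 ->
  #|[set i | x ord0 i == al1]%SET| = a ->
  #|[set i | x ord0 i == al2]%SET| = b -> (a <= b)%N ->
  labelled_triple x 0 a b (- (al1 + al2)) al1 al2.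
Proof.
move=> al_neq xE al12 d1 d2 ha hb ab.
have lamE (al : R) : al = al1 \/ al = al2 \/ al = - (al1 + al2) ->
    al ^+ 3 - al = al1 ^+ 3 - al1.
  have e2 : al2 ^+ 3 - al2 = al1 ^+ 3 - al1.
    apply/eqP; rewrite -subr_eq0.
    have -> : al2 ^+ 3 - al2 - (al1 ^+ 3 - al1) =
      (al2 - al1) * (al1 ^+ 2 + al1 * al2 + al2 ^+ 2 - 1) by ring.
    by rewrite al12 subrr mulr0.
  move=> [->//|[->//|->]]; apply/eqP; rewrite -subr_eq0.
  have -> : (- (al1 + al2)) ^+ 3 - - (al1 + al2) - (al1 ^+ 3 - al1) =
    - (2 * al1 + al2) * (al1 ^+ 2 + al1 * al2 + al2 ^+ 2 - 1) by ring.
  by rewrite al12 subrr mulr0.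
have n1 : - (al1 + al2) != al1.
  apply/eqP => e; have e2 : al2 = - 2 * al1 by lra.
  by move: al12 d1; rewrite e2 => h; have : 3 * al1 ^+ 2 = 1; lra.
have n2 : - (al1 + al2) != al2.
  apply/eqP => e; have e2 : al1 = - 2 * al2 by lra.
  by move: al12 d2; rewrite e2 => h; have : 3 * al2 ^+ 2 = 1; lra.
exists (al1 ^+ 3 - al1); split.
- by move=> i; apply: lamE; case: (xE i); [left|right; left].
- by rewrite /= !inE negb_or n1 n2 al_neq.
- move=> xi; rewrite !inE => /or3P[] /eqP ->; rewrite lamE ?subrr//; tauto.
- split=> //; apply/eqP; rewrite cards_eq0; apply/eqP/setP => i; rewrite !inE.
  by case: (xE i) => ->; rewrite eq_sym; apply/negbTE.
- by rewrite ab.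
Qed.

End TwoValuedMinimum.

(** * The gradient flow *)

Section GradientFlow.
Variables (R : realType) (N : nat).
Implicit Types (x z : 'rV[R]_N) (g : R -> 'rV[R]_N).

Definition meanf x : R := N%:R^-1 * \sum_j (x ord0 j ^+ 3 - x ord0 j).

Lemma gradS_coord x i : gradS x ord0 i = x ord0 i ^+ 3 - x ord0 i - meanf x.
Proof.
rewrite /gradS gradE mulmxBr mulmx1 -scalemxAr !mxE; congr (_ - _ * _).
by apply: eq_bigr => j _; rewrite !mxE mulr1.
Qed.

Lemma is_derive_rowP g (t : R) (d : 'rV[R]_N) :
  is_derive t (1 : R) g d <->
  forall i, is_derive t (1 : R) (fun t => g t ord0 i) (d ord0 i).
Proof.
split=> [[dg gd] i|dg].
  split; first exact: ((derivable_mxP _ _ _).1 dg).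
  by have /matrixP/(_ ord0 i) := derive_mx dg; rewrite gd mxE.
have dgt : derivable g t 1.
  by apply/derivable_mxP => i j; rewrite (ord1 i); case: (dg j).
split=> //; apply/rowP => i; rewrite derive_mx// mxE.
by case: (dg i).
Qed.

Lemma flow_line_coord g : flow_line g -> forall i (t : R),
  is_derive t (1 : R) (fun t => g t ord0 i)
    (- (g t ord0 i ^+ 3 - g t ord0 i) + meanf (g t)).
Proof.
move=> gf i t; have [_ /is_derive_rowP/(_ i)] := gf t.
by rewrite mxE gradS_coord opprB addrC.
Qed.

Definition pair_rate (a b : R) : R := 1 - (a ^+ 2 + a * b + b ^+ 2).

Lemma flow_line_pair g : flow_line g -> forall i j (t : R),
  is_derive t (1 : R) (fun t => g t ord0 i - g t ord0 j)
    ((g t ord0 i - g t ord0 j) * pair_rate (g t ord0 i) (g t ord0 j)).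
Proof.
move=> gf i j t; have di := flow_line_coord gf i; have dj := flow_line_coord gf j.
by deriv_eq; rewrite /pair_rate; ring.
Qed.

Lemma derivable_pair_rate g : flow_line g -> forall i j (t : R),
  derivable (fun t => pair_rate (g t ord0 i) (g t ord0 j)) t 1.
Proof.
move=> gf i j t; have di := flow_line_coord gf i; have dj := flow_line_coord gf j.
by rewrite /pair_rate; derivable.
Qed.

Lemma flow_line_eq g i j (s t : R) : flow_line g ->
  g s ord0 i = g s ord0 j -> g t ord0 i = g t ord0 j.
Proof.
move=> gf gij; apply/eqP; rewrite -subr_eq0; apply/eqP.
by apply: (linear_ode_eq0 t (flow_line_pair gf i j)
  (@derivable_pair_rate g gf i j) (s := s)); rewrite gij subrr.
Qed.

Lemma flow_line_back_eq g z i j (t : R) : flow_line g ->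
  g t @[t --> -oo] --> z -> z ord0 i = z ord0 j -> 1 < 3 * z ord0 i ^+ 2 ->
  g t ord0 i = g t ord0 j.
Proof.
move=> gf gz zij zi; apply/eqP; rewrite -subr_eq0; apply/eqP.
have ci : g t ord0 i @[t --> -oo] --> z ord0 i by exact: cvg_coord.
have cj : g t ord0 j @[t --> -oo] --> z ord0 j by exact: cvg_coord.
apply: (linear_ode_back_eq0 (flow_line_pair gf i j) (@derivable_pair_rate g gf i j)).
  have c : pair_rate (g t ord0 i) (g t ord0 j) @[t --> -oo] -->
      pair_rate (z ord0 i) (z ord0 j).
    apply: cvgB; first exact: cvg_cst.
    apply: cvgD; last exact: (cvg_sqr cj).
    by apply: cvgD; [exact: (cvg_sqr ci) | exact: (cvgM ci cj)].
  apply: (cvgr_le _ c); rewrite -zij /pair_rate; lra.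
rewrite -[X in _ --> X](subrr (z ord0 i)) {2}zij; exact: (cvgB ci cj).
Qed.

End GradientFlow.

Section Components.
Variables (R : realType) (T : topologicalType).

(** A connected set that meets both X and Y would contain a zero of f. *)
Lemma connected_component_signs (X Y : set T) (f : T -> R) y :
  continuous f -> connected X -> (forall u, X u -> 0 < f u) ->
  (forall u, Y u -> f u < 0) -> X y -> connected_component (X `|` Y) y = X.
Proof.
move=> cf cX X0 Y0 Xy; apply/seteqP; split; last first.
  by apply: connected_component_max => //; exact: subsetUl.
move=> u [C [Cy CXY cC] Cu]; have [//|Yu] := CXY u Cu.
have cI : connected (f @` C).
  by apply: connected_continuous_connected => //; exact: continuous_subspaceT.
move/connected_intervalP: cI => /(_ (f u) (f y)).
have fu : (f @` C) (f u) by exists u.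
have fy : (f @` C) (f y) by exists y.
move=> /(_ fu fy 0); rewrite (ltW (Y0 _ Yu)) (ltW (X0 _ Xy)) => /(_ isT)[v Cv fv].
by case: (CXY v Cv) => [/X0|/Y0]; rewrite fv ltxx.
Qed.

Lemma connected_range (h : R -> T) : continuous h -> connected (range h).
Proof.
move=> ch; apply: connected_continuous_connected; last exact: continuous_subspaceT.
by apply/connected_intervalP => a b _ _ c _.
Qed.

End Components.

(** * The invariant plane of a saddle *)

Section Embedding.
Variables (R : realType) (N m n : nat) (side : 'I_N -> option bool).
Variables (i0 i1 i2 : 'I_N) (eps : R).
Hypothesis NE : N = (1 + m + n)%N.
Hypothesis side0 : side i0 = None.
Hypothesis side1 : side i1 = Some false.
Hypothesis side2 : side i2 = Some true.
Hypothesis card0 : #|[pred i | side i == None]| = 1%N.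
Hypothesis card1 : #|[pred i | side i == Some false]| = m.
Hypothesis card2 : #|[pred i | side i == Some true]| = n.
Hypothesis epsE : eps = 1 \/ eps = -1.

Local Notation mR := (m%:R : R).
Local Notation nR := (n%:R : R).

Let NR : N%:R = 1 + mR + nR :> R. Proof. by rewrite NE !natrD. Qed.
Let NR0 : 1 + mR + nR != 0. Proof. by rewrite -NR NE pnatr_eq0. Qed.
Let eps2 : eps * eps = 1. Proof. by case: epsE => ->; ring. Qed.

Lemma sum_side (h : option bool -> R) :
  \sum_i h (side i) = h None + mR * h (Some false) + nR * h (Some true).
Proof.
rewrite (bigID (fun i => side i == None))/=.
rewrite [X in _ + X](bigID (fun i => side i == Some false))/= addrA.
rewrite (eq_bigr (fun=> h None)) => [|i /eqP ->//].
rewrite [X in _ + X + _](eq_bigl [pred i | side i == Some false]) => [|i]; last first.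
  by rewrite inE; case: (side i) => [[]|].
rewrite [X in _ + X + _](eq_bigr (fun=> h (Some false))) => [|i /eqP ->//].
rewrite [X in _ + _ + X](eq_bigl [pred i | side i == Some true]) => [|i]; last first.
  by rewrite inE; case: (side i) => [[]|].
rewrite [X in _ + _ + X](eq_bigr (fun=> h (Some true))) => [|i /eqP ->//].
by rewrite !sumr_const card0 card1 card2 mulr1n -[h (Some false) *+ _]mulr_natl
  -[h (Some true) *+ _]mulr_natl.
Qed.

Definition offset (s : option bool) (p q : R) : R :=
  match s with None => 0 | Some false => - p | Some true => q end.

Definition emb (p q : R) : 'rV[R]_N :=
  \row_i (eps * (mid mR nR p q + offset (side i) p q)).

Definition readP (x : 'rV[R]_N) : R := eps * (x ord0 i0 - x ord0 i1).
Definition readQ (x : 'rV[R]_N) : R := eps * (x ord0 i2 - x ord0 i0).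

Lemma readP_emb p q : readP (emb p q) = p.
Proof. by rewrite /readP !mxE side0 side1 /offset; case: epsE => ->; ring. Qed.

Lemma readQ_emb p q : readQ (emb p q) = q.
Proof. by rewrite /readQ !mxE side0 side2 /offset; case: epsE => ->; ring. Qed.

Lemma emb_lin p q : emb p q = p *: emb 1 0 + q *: emb 0 1.
Proof.
apply/rowP => i; rewrite !mxE /mid /offset.
by case: (side i) => [[]|]; field.
Qed.

Lemma cvg_emb (T : Type) (F : set_system T) {FF : Filter F} (p q : T -> R) P Q :
  p t @[t --> F] --> P -> q t @[t --> F] --> Q ->
  emb (p t) (q t) @[t --> F] --> emb P Q.
Proof.
move=> pP qQ; rewrite emb_lin; under eq_fun do rewrite emb_lin.
by apply: cvgD; apply: cvgZr_tmp.
Qed.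

Lemma emb_zero_sum p q : zero_sum (emb p q).
Proof.
rewrite /zero_sum/=; under eq_bigr do rewrite mxE.
rewrite (sum_side (fun s => eps * (mid mR nR p q + offset s p q))) /offset /mid.
by field.
Qed.

Definition side_constant (x : 'rV[R]_N) :=
  forall i j, side i = side j -> x ord0 i = x ord0 j.

(** Where the sum condition enters: it determines the coordinate at i0 from the
    two differences. *)
Lemma emb_readK x : zero_sum x -> side_constant x -> x = emb (readP x) (readQ x).
Proof.
move=> x0 xc.
pose h s : R := match s with
  | None => x ord0 i0 | Some false => x ord0 i1 | Some true => x ord0 i2 end.
have xE i : x ord0 i = h (side i).
  by rewrite /h; case E: (side i) => [[]|]; apply: xc; rewrite E.
have : \sum_i h (side i) = 0.
  by rewrite -[RHS]x0; apply: eq_bigr => i _; rewrite xE.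
rewrite sum_side /h => sum0.
apply/rowP => i; rewrite mxE xE /h /mid /readP /readQ /offset.
set u := x ord0 i0 in sum0 *; set v := x ord0 i1 in sum0 *.
set w := x ord0 i2 in sum0 *.
have uE : eps * ((mR * (eps * (u - v)) - nR * (eps * (w - u))) / (1 + mR + nR)) = u.
  transitivity ((u * (1 + mR + nR) - (u + mR * v + nR * w)) / (1 + mR + nR)).
    by case: epsE => ->; field.
  by rewrite sum0 subr0 mulfK.
rewrite mulrDr uE; case: (side i) => [[]|]; rewrite ?mulrN ?mulrA ?eps2; ring.
Qed.

Lemma meanf_emb p q : meanf (emb p q) = eps * (
  (mid mR nR p q ^+ 3 - mid mR nR p q) +
  mR * ((mid mR nR p q - p) ^+ 3 - (mid mR nR p q - p)) +
  nR * ((mid mR nR p q + q) ^+ 3 - (mid mR nR p q + q))) / (1 + mR + nR).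
Proof.
rewrite /meanf; under eq_bigr do rewrite mxE.
rewrite (sum_side (fun s => (eps * (mid mR nR p q + offset s p q)) ^+ 3
  - eps * (mid mR nR p q + offset s p q))) /offset NR addr0.
by case: epsE => ->; field.
Qed.

Lemma flow_line_emb (p q : R -> R) : planar_flow mR nR p q ->
  flow_line (fun t => emb (p t) (q t)).
Proof.
move=> flow t; split; first exact: emb_zero_sum.
have dp (s : R) : is_derive s (1 : R) p (p s * rateP mR nR (p s) (q s)).
  by case: (flow s).
have dq (s : R) : is_derive s (1 : R) q (q s * rateQ mR nR (p s) (q s)).
  by case: (flow s).
apply/is_derive_rowP => i; rewrite mxE gradS_coord meanf_emb mxE.
have -> : (fun t => emb (p t) (q t) ord0 i) = fun t =>
    eps * ((mR * p t - nR * q t) / (1 + mR + nR) + offset (side i) (p t) (q t)).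
  by apply/funext => u; rewrite mxE.
case: (side i) => [[]|]; rewrite /offset; deriv_eq; rewrite /rateP /rateQ /mid;
  by case: epsE => ->; field.
Qed.

Lemma planar_flow_read g : flow_line g -> (forall t, side_constant (g t)) ->
  planar_flow mR nR (fun t => readP (g t)) (fun t => readQ (g t)).
Proof.
move=> gf gc t.
have gE : g t = emb (readP (g t)) (readQ (g t)).
  by apply: emb_readK => //; case: (gf t).
have d01 := flow_line_pair gf i0 i1.
have d20 := flow_line_pair gf i2 i0.
have [e0 e1 e2] : [/\ g t ord0 i0 = eps * mid mR nR (readP (g t)) (readQ (g t)),
    g t ord0 i1 = eps * (mid mR nR (readP (g t)) (readQ (g t)) - readP (g t)) &
    g t ord0 i2 = eps * (mid mR nR (readP (g t)) (readQ (g t)) + readQ (g t))].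
  by split; rewrite {1}gE mxE ?side0 ?side1 ?side2 /offset ?addr0.
split.
- have -> : (fun t => readP (g t)) = fun t => eps * (g t ord0 i0 - g t ord0 i1) by [].
  notypeclasses refine (is_derive_eq (derivM (deriv_cst eps t) (d01 t)) _).
  rewrite mul0r add0r mulrA -/(readP (g t)); congr (_ * _).
  rewrite /pair_rate e0 e1 /rateP.
  by case: epsE => ->; ring.
- have -> : (fun t => readQ (g t)) = fun t => eps * (g t ord0 i2 - g t ord0 i0) by [].
  notypeclasses refine (is_derive_eq (derivM (deriv_cst eps t) (d20 t)) _).
  rewrite mul0r add0r mulrA -/(readQ (g t)); congr (_ * _).
  rewrite /pair_rate e0 e2 /rateQ.
  by case: epsE => ->; ring.
Qed.

Section Connection.
Variables P Q Qx Py : R.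
Hypothesis A0 : 0 < 2 * mR - nR - 1.
Hypothesis B0 : 0 < 2 * nR - mR - 1.
Hypothesis P0 : 0 < P.
Hypothesis Q0 : 0 < Q.
Hypothesis ellPQ : ell mR nR P Q = 0.
Hypothesis ratePQ : rateP mR nR P Q = 0.
Hypothesis rateQPQ : rateQ mR nR P Q = 0.
Hypothesis Qx0 : 0 < Qx.
Hypothesis rateQx : rateQ mR nR 0 Qx = 0.
Hypothesis Py0 : 0 < Py.
Hypothesis ratePy : rateP mR nR Py 0 = 0.

Let z := emb P Q.

Let mR0 : 0 <= mR. Proof. exact: ler0n. Qed.
Let nR0 : 0 <= nR. Proof. exact: ler0n. Qed.

Let side_inj i j : side i = None -> side j = None -> i = j.
Proof.
move=> si sj; have /card_le1_eqP := eq_leq card0.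
by apply; rewrite inE ?si ?sj.
Qed.

(** That is, the three coordinate values of z have sum 0. *)
Let mid3 : 3 * mid mR nR P Q = P - Q.
Proof.
apply: (mulIf NR0); rewrite /mid mulrA divfK//.
by move: ellPQ; rewrite /ell; lra.
Qed.

(** If s1, s2, s3 are the roots of s^3 - s - lam then 3 s1^2 - 1 is
    (s1 - s2) (s1 - s3), which is positive at the two outer roots. *)
Let outer_gt1 i : side i != None -> 1 < 3 * z ord0 i ^+ 2.
Proof.
rewrite mxE exprMn expr2 eps2 mul1r /offset.
have PQ0 : 0 < P + Q by exact: addr_gt0.
have hP : 0 < P * (P + Q) by exact: mulr_gt0.
have hQ : 0 < Q * (P + Q) by exact: mulr_gt0.
have uE : mid mR nR P Q = (P - Q) / 3 by rewrite -mid3 mulrC mulKf.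
move: ratePQ rateQPQ; rewrite /rateP /rateQ uE.
by case: (side i) => [[]|//] hp hq _; lra.
Qed.

Lemma unstable_side_constant g : flow_line g -> g t @[t --> -oo] --> z ->
  forall t, side_constant (g t).
Proof.
move=> gf gz t i j sij.
have [si|si] := eqVneq (side i) None.
  by congr (_ _ _); apply: side_inj => //; rewrite -sij.
apply: (flow_line_back_eq t gf gz); last exact: outer_gt1.
by rewrite !mxE sij.
Qed.

Let cvg_readP (T : Type) (F : set_system T) {FF : Filter F}
  (g : T -> 'rV[R]_N) x : g t @[t --> F] --> x -> readP (g t) @[t --> F] --> readP x.
Proof.
move=> gx; apply: cvgM; first exact: cvg_cst.
by apply: cvgB; exact: cvg_coord.
Qed.

Let cvg_readQ (T : Type) (F : set_system T) {FF : Filter F}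
  (g : T -> 'rV[R]_N) x : g t @[t --> F] --> x -> readQ (g t) @[t --> F] --> readQ x.
Proof.
move=> gx; apply: cvgM; first exact: cvg_cst.
by apply: cvgB; exact: cvg_coord.
Qed.

Let height (x : 'rV[R]_N) : R := ell mR nR (readP x) (readQ x).

Let height_emb p q : height (emb p q) = ell mR nR p q.
Proof. by rewrite /height readP_emb readQ_emb. Qed.

Let cvg_height (T : Type) (F : set_system T) {FF : Filter F}
  (g : T -> 'rV[R]_N) x : g t @[t --> F] --> x -> height (g t) @[t --> F] --> height x.
Proof.
move=> gx; apply: cvgB; apply: cvgM; try exact: cvg_cst.
  exact: cvg_readP.
exact: cvg_readQ.
Qed.

Let continuous_height : continuous height.
Proof. by move=> x; exact: (@cvg_height _ (nbhs x) (nbhs_filter x) id x). Qed.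

Let continuous_flow p q : planar_flow mR nR p q ->
  continuous (fun t => emb (p t) (q t)).
Proof.
move=> flow t; apply: cvg_emb; apply: derivable_continuous.
  by have [[]] := flow t.
by have [_ []] := flow t.
Qed.

(** Off the invariant line an orbit never meets z, and shifts in time carry any
    of its points to time 0. *)
Let orbit_unstable p q : planar_flow mR nR p q ->
  (forall t, ell mR nR (p t) (q t) != 0) ->
  p t @[t --> -oo] --> P -> q t @[t --> -oo] --> Q ->
  range (fun t => emb (p t) (q t)) `<=` unstable_manifold z `\ z.
Proof.
move=> flow l0 pP qQ _ [s _ <-]; split; last first.
  by move=> /= e; have := l0 s; rewrite -height_emb e height_emb ellPQ eqxx.
exists (fun t => emb (p (t + s)) (q (t + s))); split.
- exact/flow_line_emb/planar_flow_shift.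
- by rewrite add0r.
have sh : t + s @[t --> -oo] --> -oo by exact: cvg_addrr_Ny.
apply: cvg_emb; first exact: (@cvg_comp _ _ _ (fun t => t + s) p _ _ _ sh pP).
exact: (@cvg_comp _ _ _ (fun t => t + s) q _ _ _ sh qQ).
Qed.

(** The left branch is obtained from the right one by the exchange of (m, p) and
    (n, q).  That each branch contains a flow line makes the limits of the
    branches unique. *)
Lemma saddle_connection : exists bleft bright : set 'rV[R]_N,
  [/\ bleft <> bright, branches z = [set bleft; bright],
      converges_to bleft (emb 0 Qx), converges_to bright (emb Py 0) &
      forall b, branches z b -> exists g, flow_line g /\ b (g 0)].
Proof.
have [p [q [flow pos [pP qQ] uniq]]] :=
  planar_unstable mR0 nR0 A0 B0 Q0 ellPQ rateQPQ.
have ellQP : ell nR mR Q P = 0 by rewrite ell_swap ellPQ oppr0.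
have rateQP : rateQ nR mR Q P = 0 by rewrite rateQ_swap.
have [q' [p' [flow' pos' [q'Q p'P] uniq']]] :=
  planar_unstable nR0 mR0 B0 A0 P0 ellQP rateQP.
have {}flow' := planar_flow_swap flow'.
pose bright := range (fun t => emb (p t) (q t)).
pose bleft := range (fun t => emb (p' t) (q' t)).
have by_gt0 u : bright u -> 0 < height u.
  by move=> [t _ <-]; rewrite height_emb; case: (pos t).
have bx_lt0 u : bleft u -> height u < 0.
  by move=> [t _ <-]; rewrite height_emb -oppr_gt0 -ell_swap; case: (pos' t).
have unstableE : unstable_manifold z `\ z = bright `|` bleft.
  apply/seteqP; split; last first.
    rewrite subUset; split; apply: orbit_unstable => // t.
      by rewrite gt_eqF//; case: (pos t).
    by rewrite lt_eqF// -oppr_gt0 -ell_swap; case: (pos' t).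
  move=> y [[g [gf gy gz]] yz].
  have gc := unstable_side_constant gf gz.
  have gE t : g t = emb (readP (g t)) (readQ (g t)).
    by apply: emb_readK => //; case: (gf t).
  have flow1 := planar_flow_read gf gc.
  have p1P : readP (g t) @[t --> -oo] --> P.
    by rewrite -[P](readP_emb P Q); exact: cvg_readP.
  have q1Q : readQ (g t) @[t --> -oo] --> Q.
    by rewrite -[Q](readQ_emb P Q); exact: cvg_readQ.
  have [T1 [_ T1P]] : \forall t \near -oo, 0 < readP (g t) by exact: (cvgr_gt _ p1P).
  have [T2 [_ T2P]] : \forall t \near -oo, 0 < readQ (g t) by exact: (cvgr_gt _ q1Q).
  have p10 t : 0 < readP (g t).
    by apply: (flow_p_gt0 flow1 t (s := T1 - 1)); apply: T1P; lra.
  have q10 t : 0 < readQ (g t).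
    by apply: (flow_q_gt0 flow1 t (s := T2 - 1)); apply: T2P; lra.
  have [l_lt0|l_gt0|l_eq0] := ltgtP (height (g 0)) 0.
  - right; have lN t : 0 < ell nR mR (readQ (g t)) (readP (g t)).
      apply: (flow_ell_gt0 (planar_flow_swap flow1) t (s := 0)).
        by rewrite addrAC.
      by rewrite ell_swap oppr_gt0.
    have [s sE] := uniq' _ _ (planar_flow_swap flow1)
      (fun t => And3 (q10 t) (p10 t) (lN t)) q1Q p1P.
    by exists (0 + s) => //; rewrite -gy gE; have [-> ->] := sE 0.
  - left; have lN t : 0 < ell mR nR (readP (g t)) (readQ (g t)).
      exact: (flow_ell_gt0 flow1 t (s := 0)).
    have [s sE] := uniq _ _ flow1
      (fun t => And3 (p10 t) (q10 t) (lN t)) p1P q1Q.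
    by exists (0 + s) => //; rewrite -gy gE; have [-> ->] := sE 0.
  - case: yz; rewrite /= -gy gE.
    by have [-> ->] := planar_center mR0 nR0 A0 flow1 l_eq0 Q0 ellPQ rateQPQ q1Q 0.
have by_comp u : bright u ->
    connected_component (unstable_manifold z `\ z) u = bright.
  move=> byu; rewrite unstableE.
  apply: (connected_component_signs continuous_height) => //.
  by apply: connected_range; exact: continuous_flow.
have bx_comp u : bleft u ->
    connected_component (unstable_manifold z `\ z) u = bleft.
  move=> bxu; rewrite unstableE setUC.
  apply: (@connected_component_signs _ _ _ _ (fun v => - height v)) => //.
  - by move=> v; apply: continuousN; exact: continuous_height.
  - by apply: connected_range; exact: continuous_flow.
  - by move=> v /bx_lt0; rewrite oppr_gt0.
  - by move=> v /by_gt0; rewrite oppr_lt0.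
have by0 : bright (emb (p 0) (q 0)) by exists 0.
have bx0 : bleft (emb (p' 0) (q' 0)) by exists 0.
have branchE : branches z = [set bleft; bright].
  rewrite /branches; apply/seteqP; split.
    move=> _ [u uU <-]; move: (uU); rewrite {1}unstableE => -[byu|bxu].
      by right; exact: by_comp.
    by left; exact: bx_comp.
  move=> _ [->|->].
    by exists (emb (p' 0) (q' 0)); [rewrite unstableE; right|exact: bx_comp].
  by exists (emb (p 0) (q 0)); [rewrite unstableE; left|exact: by_comp].
have read0 g : flow_line g -> side_constant (g 0) ->
    planar_flow mR nR (fun t => readP (g t)) (fun t => readQ (g t)) /\
    forall t, g t = emb (readP (g t)) (readQ (g t)).
  move=> gf g0; have gc t : side_constant (g t).
    by move=> i j sij; apply: (flow_line_eq t gf (g0 i j sij)).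
  split; first exact: planar_flow_read.
  by move=> t; apply: emb_readK => //; case: (gf t).
have emb_const p1 q1 : side_constant (emb p1 q1) by move=> i j sij; rewrite !mxE sij.
exists bleft, bright; split => //.
- move=> bxy; have := bx_lt0 _ bx0; rewrite ltNge => /negP; apply.
  by apply/ltW/by_gt0; rewrite -bxy.
- move=> g gf [t _ g0].
  have [|flow1 gE] := read0 g gf; first by rewrite -g0.
  have rQ : rateP nR mR Qx 0 = 0 by rewrite rateP_swap.
  have [|||qc pc] :=
    planar_forward nR0 mR0 B0 A0 (planar_flow_swap flow1) _ _ _ Qx0 rQ.
  + by rewrite -g0 readQ_emb; case: (pos' t).
  + by rewrite -g0 readP_emb; case: (pos' t).
  + by rewrite -g0 readP_emb readQ_emb; case: (pos' t).
  by under eq_fun do rewrite gE; exact: cvg_emb.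
- move=> g gf [t _ g0].
  have [|flow1 gE] := read0 g gf; first by rewrite -g0.
  have [|||pc qc] := planar_forward mR0 nR0 A0 B0 flow1 _ _ _ Py0 ratePy.
  + by rewrite -g0 readP_emb; case: (pos t).
  + by rewrite -g0 readQ_emb; case: (pos t).
  + by rewrite -g0 readP_emb readQ_emb; case: (pos t).
  by under eq_fun do rewrite gE; exact: cvg_emb.
- move=> b; rewrite branchE => -[->|->].
    by exists (fun t => emb (p' t) (q' t)); split => //; exact: flow_line_emb.
  by exists (fun t => emb (p t) (q t)); split => //; exact: flow_line_emb.
Qed.

End Connection.

Section Endpoints.
Hypothesis A0 : 0 < 2 * mR - nR - 1.
Hypothesis B0 : 0 < 2 * nR - mR - 1.

Let N0 : (0 < N)%N. Proof. by rewrite NE. Qed.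
Let NR_gt0 : 0 < 1 + mR + nR. Proof. by rewrite -NR ltr0n. Qed.

Lemma card_side_pred (x : 'rV[R]_N) (v : R) (s : pred (option bool)) :
  (forall i, (x ord0 i == v) = s (side i)) ->
  #|[set i | x ord0 i == v]%SET| = (s None + s (Some false) * m + s (Some true) * n)%N.
Proof.
move=> xs; have cE : #|[set i | x ord0 i == v]%SET| = (\sum_i s (side i))%N.
  rewrite -sum1_card big_mkcond/=; apply: eq_bigr => i _.
  by rewrite inE xs; case: (s _).
apply/eqP; rewrite -(eqr_nat R) cE natr_sum.
rewrite (sum_side (fun t => (s t)%:R)) !natrD !natrM mulrC.
by apply/eqP; ring.
Qed.

(** Both differences 3 v1^2 - 1 and 3 v2^2 - 1 are, up to a multiple of the rate
    that vanishes here, Q^2 / N times a linear form in m and n. *)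
Lemma left_endpoint Q (v1 := eps * mid mR nR 0 Q)
    (v2 := eps * (mid mR nR 0 Q + Q)) :
  0 < Q -> rateQ mR nR 0 Q = 0 -> (m < n)%N ->
  local_minimum (emb 0 Q) /\
  labelled_triple (emb 0 Q) 0 m.+1 n (- (v1 + v2)) v1 v2.
Proof.
move=> Q0 rQ mn.
have xE i : emb 0 Q ord0 i = if side i == Some true then v2 else v1.
  by rewrite mxE /offset /v1 /v2; case: (side i) => [[]|]; rewrite ?oppr0 ?addr0.
have v12 : v1 != v2.
  rewrite -subr_eq0 /v1 /v2 -mulrBr opprD addrA subrr add0r mulrN oppr_eq0.
  by rewrite mulf_eq0 negb_or (gt_eqF Q0) andbT; case: epsE => ->; rewrite ?oppr_eq0 oner_eq0.
have x2 i : emb 0 Q ord0 i = v1 \/ emb 0 Q ord0 i = v2.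
  by rewrite xE; case: ifP; [right|left].
have Q2 : 0 < Q ^+ 2 by rewrite exprn_gt0.
have al12 : v1 ^+ 2 + v1 * v2 + v2 ^+ 2 = 1.
  apply/eqP; rewrite -subr_eq0 -oppr_eq0 -[X in _ == X]rQ /rateQ /v1 /v2; apply/eqP.
  by case: epsE => ->; ring.
have d1 : 0 < 3 * v1 ^+ 2 - 1.
  have -> : 3 * v1 ^+ 2 - 1 = Q ^+ 2 * (2 * nR - mR - 1) / (1 + mR + nR) + - rateQ mR nR 0 Q.
    by rewrite /rateQ /v1 /mid; case: epsE => ->; field.
  by rewrite rQ oppr0 addr0 divr_gt0 ?mulr_gt0.
have d2 : 0 < 3 * v2 ^+ 2 - 1.
  have -> : 3 * v2 ^+ 2 - 1 =
      Q ^+ 2 * (2 + 2 * mR - nR) / (1 + mR + nR) + - rateQ mR nR 0 Q.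
    by rewrite /rateQ /v2 /mid; case: epsE => ->; field.
  rewrite rQ oppr0 addr0 divr_gt0 ?mulr_gt0//.
  by move: A0; lra.
split; first exact: local_minimum_two_valued (emb_zero_sum 0 Q) x2 al12 d1 d2.
apply: labelled_triple_two_valued => //.
- rewrite (card_side_pred (s := fun t => t != Some true)); first by rewrite /= mul1n mul0n addn0.
  move=> i; rewrite xE; case: ifP => _; last by rewrite eqxx.
  by rewrite eq_sym (negbTE v12).
- rewrite (card_side_pred (s := fun t => t == Some true)); first by rewrite /= mul1n.
  by move=> i; rewrite xE; case: ifP => _; rewrite ?eqxx// (negbTE v12).
Qed.

Lemma right_endpoint P (v1 := eps * (mid mR nR P 0 - P))
    (v2 := eps * mid mR nR P 0) :
  0 < P -> rateP mR nR P 0 = 0 -> (m <= n.+1)%N ->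
  local_minimum (emb P 0) /\
  labelled_triple (emb P 0) 0 m n.+1 (- (v1 + v2)) v1 v2.
Proof.
move=> P0 rP mn.
have xE i : emb P 0 ord0 i = if side i == Some false then v1 else v2.
  by rewrite mxE /offset /v1 /v2; case: (side i) => [[]|]; rewrite ?addr0.
have v12 : v1 != v2.
  rewrite -subr_eq0 /v1 /v2 -mulrBr addrAC subrr add0r mulrN oppr_eq0.
  by rewrite mulf_eq0 negb_or (gt_eqF P0) andbT; case: epsE => ->; rewrite ?oppr_eq0 oner_eq0.
have x2 i : emb P 0 ord0 i = v1 \/ emb P 0 ord0 i = v2.
  by rewrite xE; case: ifP; [left|right].
have P2 : 0 < P ^+ 2 by rewrite exprn_gt0.
have al12 : v1 ^+ 2 + v1 * v2 + v2 ^+ 2 = 1.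
  apply/eqP; rewrite -subr_eq0 -oppr_eq0 -[X in _ == X]rP /rateP /v1 /v2; apply/eqP.
  by case: epsE => ->; ring.
have d1 : 0 < 3 * v1 ^+ 2 - 1.
  have -> : 3 * v1 ^+ 2 - 1 =
      P ^+ 2 * (2 + 2 * nR - mR) / (1 + mR + nR) + - rateP mR nR P 0.
    by rewrite /rateP /v1 /mid; case: epsE => ->; field.
  rewrite rP oppr0 addr0 divr_gt0 ?mulr_gt0//.
  by move: B0; lra.
have d2 : 0 < 3 * v2 ^+ 2 - 1.
  have -> : 3 * v2 ^+ 2 - 1 = P ^+ 2 * (2 * mR - nR - 1) / (1 + mR + nR) + - rateP mR nR P 0.
    by rewrite /rateP /v2 /mid; case: epsE => ->; field.
  by rewrite rP oppr0 addr0 divr_gt0 ?mulr_gt0.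
split; first exact: local_minimum_two_valued (emb_zero_sum P 0) x2 al12 d1 d2.
apply: labelled_triple_two_valued => //.
- rewrite (card_side_pred (s := fun t => t == Some false)); first by rewrite /= mul1n mul0n addn0.
  by move=> i; rewrite xE; case: ifP => _; rewrite ?eqxx// eq_sym (negbTE v12).
- rewrite (card_side_pred (s := fun t => t != Some false)); first by rewrite /= mul0n mul1n addn0.
  by move=> i; rewrite xE; case: ifP => _; rewrite ?eqxx// (negbTE v12).
Qed.

End Endpoints.

End Embedding.

Lemma exists_rateP_eq0 (R : realType) (m n : R) : 0 <= m -> 0 <= n ->
  exists2 P : R, 0 < P & rateP m n P 0 = 0.
Proof.
move=> m0 n0; have N0 : 1 + m + n != 0 by rewrite gt_eqF//; lra.
pose w := - (m / (1 + m + n)); pose c := 3 * w ^+ 2 + 3 * w + 1.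
have c0 : 0 < c by exact: quad_gt0.
exists (Num.sqrt c^-1); first by rewrite sqrtr_gt0 invr_gt0.
have -> : rateP m n (Num.sqrt c^-1) 0 = 1 - c * Num.sqrt c^-1 ^+ 2.
  by rewrite /rateP /mid /c /w; field.
by rewrite sqr_sqrtr ?invr_ge0 ?(ltW c0)// mulfV ?subrr// gt_eqF.
Qed.

(** * The connection rules *)

Lemma distinct_roots_vieta (R : realType) (lam a0 a1 a2 : R) :
  uniq [:: a0; a1; a2] ->
  {in [:: a0; a1; a2], forall xi, xi ^+ 3 - xi - lam = 0} ->
  [/\ a0 + a1 + a2 = 0, a0 ^+ 2 + a0 * a1 + a1 ^+ 2 = 1,
      a0 ^+ 2 + a0 * a2 + a2 ^+ 2 = 1 &
      forall x, x ^+ 3 - x = lam -> [\/ x = a0, x = a1 | x = a2]].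
Proof.
rewrite /= !inE negb_or andbT => /andP[/andP[n01 n02] n12] roots.
have pair a b : a != b -> a ^+ 3 - a - lam = 0 -> b ^+ 3 - b - lam = 0 ->
    a ^+ 2 + a * b + b ^+ 2 = 1.
  rewrite -subr_eq0 => ab ha hb; apply/eqP; rewrite -subr_eq0; apply/eqP.
  apply: (mulfI ab); rewrite mulr0 -[RHS](subrr (0 : R)) -{1}ha -hb; ring.
have r0 := roots a0 (mem_head _ _).
have r1 : a1 ^+ 3 - a1 - lam = 0 by apply: roots; rewrite !inE eqxx orbT.
have r2 : a2 ^+ 3 - a2 - lam = 0 by apply: roots; rewrite !inE eqxx !orbT.
have p01 := pair _ _ n01 r0 r1; have p02 := pair _ _ n02 r0 r2.
have sum0 : a0 + a1 + a2 = 0.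
  move: n12; rewrite -subr_eq0 => n12; apply: (mulfI n12).
  rewrite mulr0 -[RHS](subrr (1 : R)) -{1}p01 -p02; ring.
split=> // x xl; have [->|x0] := eqVneq x a0; first by constructor.
have [->|x1] := eqVneq x a1; first by constructor 2.
constructor 3; apply/eqP; rewrite -subr_eq0.
have px0 : x ^+ 2 + x * a0 + a0 ^+ 2 = 1 by apply: pair => //; rewrite xl subrr.
move: x1; rewrite -subr_eq0 => x1; rewrite -(mulrI_eq0 _ (lregP x1)).
apply/eqP; have -> : a2 = - (a0 + a1) by move: sum0; lra.
by rewrite -[RHS](subrr (1 : R)) -{1}px0 -p01; ring.
Qed.

Lemma exists_coord_eq (R : realType) (N c : nat) (x : 'rV[R]_N) (v : R) :
  #|[set i | x ord0 i == v]%SET| = c -> (0 < c)%N -> exists i, x ord0 i = v.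
Proof.
by move=> <- /card_gt0P[i]; rewrite inE => /eqP; exists i.
Qed.

(** Two labellings of the two branches by their limits agree or are opposite. *)
Lemma connects_unique (R : realType) (N : nat) (z x y x' y' : 'rV[R]_N)
    (bleft bright : set 'rV[R]_N) :
  branches z = [set bleft; bright] ->
  (forall b, branches z b -> exists g, flow_line g /\ b (g 0)) ->
  converges_to bleft x -> converges_to bright y ->
  connects z x' y' -> (x' = x /\ y' = y) \/ (x' = y /\ y' = x).
Proof.
move=> brE nonempty cx cy [b1 [b2 [b12 br' c1 c2]]].
have uniq b u v : branches z b -> converges_to b u -> converges_to b v -> u = v.
  move=> /nonempty[g [gf bg]] cu cv.
  exact: (cvg_unique (@norm_hausdorff _ _) (cu g gf bg) (cv g gf bg)).
have in1 : branches z b1 by rewrite br'; left.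
have in2 : branches z b2 by rewrite br'; right.
have := in1; have := in2; rewrite brE => -[] e2 -[] e1.
- by case: b12; rewrite e1 e2.
- right; split; [apply: (uniq b1) => //|apply: (uniq b2) => //].
    by rewrite e1.
  by rewrite e2.
- left; split; [apply: (uniq b1) => //|apply: (uniq b2) => //].
    by rewrite e1.
  by rewrite e2.
- by case: b12; rewrite e1 e2.
Qed.

Theorem theorem3p5 (R : realType) (N M k : nat)
  (hNM : N = (2 * M)%N) (hN8 : (8 <= N)%N) (hN3 : ~~ (3 %| N)%N)
  (hk : (1 <= k <= N %/ 6)%N) (z : 'rV[R]_N) (hz : C M k z) :
  exists x y : 'rV[R]_N,
    [/\ B M (k - 1) x, B M k y, connects z x y,
        forall x' y' : 'rV[R]_N,
          B M (k - 1) x' -> B M k y' -> connects z x' y' ->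
          x' = x /\ y' = y &
        forall al0' al1' al2' al0'' al1'' al2'' : R,
          labelled_triple z 1 (M - k) (M + k - 1) al0' al1' al2' ->
          labelled_triple y 0 (M - k) (M + k) al0'' al1'' al2'' ->
          exists al0 al1 al2 : R,
            labelled_triple x 0 (M - (k - 1)) (M + (k - 1)) al0 al1 al2 /\
            forall i : 'I_N,
              [\/ [/\ x ord0 i = al1, z ord0 i = al0' & y ord0 i = al2''],
                  [/\ x ord0 i = al1, z ord0 i = al1' & y ord0 i = al1''] |
                  [/\ x ord0 i = al2, z ord0 i = al2' & y ord0 i = al2'']]].
Proof.
case: hz => -[[z0 _] _] [a0 [a1 [a2 [lam [zlam a_uniq a_root [c0 c1 c2] _]]]]].
have [m mE] : exists m, m = (M - k)%N by exists (M - k)%N.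
have [n nE] : exists n, n = (M + k - 1)%N by exists (M + k - 1)%N.
have [k1 k3M NE mlt m1] :
    [/\ (1 <= k)%N, (3 * k < M)%N, N = (1 + m + n)%N, (m < n)%N & (1 < m)%N].
  by clear -hNM hN3 hk mE nE; split; lia.
have [mS nS nS1] :
    [/\ m.+1 = (M - (k - 1))%N, n = (M + (k - 1))%N & n.+1 = (M + k)%N].
  by clear -k1 k3M mE nE; split; lia.
have n1 : (1 < n)%N := ltn_trans m1 mlt.
have m0 : (0 < m)%N := ltnW m1.
have n0 : (0 < n)%N := ltnW n1.
rewrite -mE in c1 *; rewrite -nE in c2 *; rewrite -mS -nS -nS1.
have [sum0 p01 p02 vals] := distinct_roots_vieta a_uniq a_root.
have /and3P[n01 n02 n12] : [&& a0 != a1, a0 != a2 & a1 != a2].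
  by move: a_uniq; rewrite /= !inE negb_or andbT andbA.
have neqE := (negbTE n01, negbTE n02, negbTE n12, eq_sym a1 a0, eq_sym a2 a0,
  eq_sym a2 a1, eqxx).
pose side (i : 'I_N) : option bool :=
  if z ord0 i == a0 then None else if z ord0 i == a1 then Some false else Some true.
have sideP i : [\/ side i = None /\ z ord0 i = a0, side i = Some false /\ z ord0 i = a1
    | side i = Some true /\ z ord0 i = a2].
  rewrite /side; have [] := vals _ (zlam i) => ->.
  - by rewrite eqxx; constructor 1.
  - by rewrite !neqE; constructor 2.
  - by rewrite !neqE; constructor 3.
have card_side s (v : R) c : #|[set i | z ord0 i == v]%SET| = c ->
    (forall i, (side i == s) = (z ord0 i == v)) -> #|[pred i | side i == s]| = c.
  by move=> <- E; apply: eq_card => i; rewrite !inE E.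
have s0 : #|[pred i | side i == None]| = 1%N.
  apply: (card_side _ a0) c0 _ => i.
  by have [] := sideP i => -[-> ->]; rewrite !neqE.
have s1 : #|[pred i | side i == Some false]| = m.
  apply: (card_side _ a1) c1 _ => i.
  by have [] := sideP i => -[-> ->]; rewrite !neqE.
have s2 : #|[pred i | side i == Some true]| = n.
  apply: (card_side _ a2) c2 _ => i.
  by have [] := sideP i => -[-> ->]; rewrite !neqE.
(* [i0], [i1] and [i2] represent the three sets of equal coordinates *)
have [i0 zi0] := exists_coord_eq c0 isT.
have [i1 zi1] := exists_coord_eq c1 m0.
have [i2 zi2] := exists_coord_eq c2 n0.
have si0 : side i0 = None by rewrite /side zi0 eqxx.
have si1 : side i1 = Some false by rewrite /side zi1 !neqE.
have si2 : side i2 = Some true by rewrite /side zi2 !neqE.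
(* the sign makes al1' < al0' < al2' after multiplication by [eps] *)
have [eps epsE eps_gt0] : exists2 eps : R, eps = 1 \/ eps = -1 & 0 < eps * (a2 - a1).
  have [a12|a21|a12] := ltgtP a1 a2; last by rewrite a12 eqxx in n12.
    by exists 1; [left|rewrite mul1r subr_gt0].
  by exists (-1); [right|rewrite mulN1r oppr_gt0 subr_lt0].
have z_const : side_constant side z.
  move=> i j; have [] := sideP i => -[-> ->]; have [] := sideP j => -[-> ->] //.
pose P := readP i0 i1 eps z; pose Q := readQ i0 i2 eps z.
have zE : z = emb m n side eps P Q.
  exact: (emb_readK NE si0 si1 si2 s0 s1 s2 epsE z0 z_const).
have PE : P = eps * (a0 - a1) by rewrite /P /readP zi0 zi1.
have QE : Q = eps * (a2 - a0) by rewrite /Q /readQ zi0 zi2.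
have weighted0 : a0 + m%:R * a1 + n%:R * a2 = 0.
  pose h s : R := match s with None => a0 | Some false => a1 | Some true => a2 end.
  rewrite -[LHS](sum_side s0 s1 s2 h) -[RHS]z0; apply: eq_bigr => i _.
  by have [] := sideP i => -[-> ->].
have midE : eps * mid m%:R n%:R P Q = a0.
  by rewrite -zi0 zE mxE si0 addr0.
have mRE : m%:R = M%:R - k%:R :> R by rewrite mE natrB//; clear -k3M; lia.
have nRE : n%:R = M%:R + k%:R - 1 :> R by rewrite nE natrB ?natrD//; clear -k3M; lia.
have k3MR : 3 * k%:R + 1 <= M%:R :> R by rewrite -[1]/(1%:R) -natrM -natrD ler_nat; clear -k3M; lia.
have k1R : 1 <= k%:R :> R by rewrite ler1n.
have A0 : 0 < 2 * m%:R - n%:R - 1 :> R by rewrite mRE nRE; lra.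
have B0 : 0 < 2 * n%:R - m%:R - 1 :> R by rewrite mRE nRE; lra.
have ellPQ : ell m%:R n%:R P Q = 0.
  have -> : ell m%:R n%:R P Q = eps * ((m%:R + n%:R + 1) * (a0 + a1 + a2) -
      3 * (a0 + m%:R * a1 + n%:R * a2)) by rewrite /ell PE QE; ring.
  by rewrite sum0 weighted0; ring.
have PQ0 : 0 < P + Q by rewrite (_ : P + Q = eps * (a2 - a1)) // PE QE; ring.
have [P0 Q0] : 0 < P /\ 0 < Q.
  have AB0 := addr_gt0 A0 B0.
  split; rewrite -(pmulr_rgt0 _ AB0).
    have -> : (2 * m%:R - n%:R - 1 + (2 * n%:R - m%:R - 1)) * P =
       (2 * n%:R - m%:R - 1) * (P + Q) + ell m%:R n%:R P Q by rewrite /ell; ring.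
    by rewrite ellPQ addr0 mulr_gt0.
  have -> : (2 * m%:R - n%:R - 1 + (2 * n%:R - m%:R - 1)) * Q =
     (2 * m%:R - n%:R - 1) * (P + Q) - ell m%:R n%:R P Q by rewrite /ell; ring.
  by rewrite ellPQ subr0 mulr_gt0.
have eps2 : eps ^+ 2 = 1 by case: epsE => ->; rewrite ?sqrrN expr1n.
have midE' : mid m%:R n%:R P Q = eps * a0 by rewrite -midE mulrA -expr2 eps2 mul1r.
have ratePQ : rateP m%:R n%:R P Q = 0.
  have -> : rateP m%:R n%:R P Q = 1 - (a0 ^+ 2 + a0 * a1 + a1 ^+ 2).
    by rewrite /rateP midE' PE; case: epsE => ->; ring.
  by rewrite p01 subrr.
have rateQPQ : rateQ m%:R n%:R P Q = 0.
  have -> : rateQ m%:R n%:R P Q = 1 - (a0 ^+ 2 + a0 * a2 + a2 ^+ 2).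
    by rewrite /rateQ midE' QE; case: epsE => ->; ring.
  by rewrite p02 subrr.
have [Qx Qx0] := exists_rateP_eq0 (ler0n R n) (ler0n R m).
rewrite rateP_swap => rateQx.
have [Py Py0 ratePy] := exists_rateP_eq0 (ler0n R m) (ler0n R n).
have [xmin xlab] := left_endpoint NE s0 s1 s2 epsE A0 B0 Qx0 rateQx mlt.
have [ymin ylab] := right_endpoint NE s0 s1 s2 epsE A0 B0 Py0 ratePy (leqW (ltnW mlt)).
have [bleft [bright [bxy brE cx cy nonempty]]] := saddle_connection NE si0 si1 si2 s0 s1 s2
  epsE A0 B0 P0 Q0 ellPQ ratePQ rateQPQ Qx0 rateQx Py0 ratePy.
rewrite -zE in brE nonempty.
set x := emb m n side eps 0 Qx in xmin xlab cx.
set y := emb m n side eps Py 0 in ymin ylab cy.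
set x1 := eps * mid _ _ 0 Qx in xlab; set x2 := eps * (mid _ _ 0 Qx + Qx) in xlab.
set y1 := eps * (mid _ _ Py 0 - Py) in ylab; set y2 := eps * mid _ _ Py 0 in ylab.
have xE i : x ord0 i = if side i == Some true then x2 else x1.
  by rewrite mxE /offset /x1 /x2; case: (side i) => [[]|]; rewrite ?oppr0 ?addr0.
have yE i : y ord0 i = if side i == Some false then y1 else y2.
  by rewrite mxE /offset /y1 /y2; case: (side i) => [[]|]; rewrite ?addr0.
have [_ [_ _ _ [_ cy1 cy2] _]] := ylab.
have Bx : B M (k - 1) x.
  by split=> //; exists (- (x1 + x2)), x1, x2; rewrite -mS -nS.
have By : B M k y by split=> //; exists (- (y1 + y2)), y1, y2; rewrite -mE -nS1.
exists x, y; split => //.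
- by exists bleft, bright.
- move=> x' y' [_ [b0 [b1 [b2 [_ [_ _ _ [_ _ cb2] _]]]]]] _ cxy.
  (* x' = y is excluded by the numbers of occurrences of its values *)
  have [//|[x'y _]] := connects_unique brE nonempty cx cy cxy.
  rewrite x'y -nS in cb2; have [i] := exists_coord_eq cb2 n0.
  rewrite yE; case: ifP => _ e; move: cb2; rewrite -e ?cy1 ?cy2 => e'; exfalso.
    by clear -e' mlt; lia.
  by clear -e'; lia.
move=> l0 l1 l2 k0 k1' k2 [_ [_ _ _ [d0 d1 d2] _]] [_ [_ _ _ [_ e1 e2] _]].
have z_count v c : #|[set i | z ord0 i == v]%SET| = c -> (0 < c)%N ->
    [\/ v = a0 /\ c = 1%N, v = a1 /\ c = m | v = a2 /\ c = n].
  move=> cv c_gt0; have [i zi] := exists_coord_eq cv c_gt0.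
  have [[_ ze]|[_ ze]|[_ ze]] := sideP i; move: cv; rewrite -zi ze ?c0 ?c1 ?c2 => <-.
  - by constructor 1.
  - by constructor 2.
  - by constructor 3.
have y_count v c : #|[set i | y ord0 i == v]%SET| = c -> (0 < c)%N ->
    (v = y1 /\ c = m) \/ (v = y2 /\ c = n.+1).
  move=> cv c_gt0; have [i yi] := exists_coord_eq cv c_gt0.
  by move: yi; rewrite yE; case: ifP => _ yi; move: cv; rewrite -yi ?cy1 ?cy2 => <-;
    [left|right].
have l0E : l0 = a0.
  have [[]//|[_ e]|[_ e]] := z_count _ _ d0 isT; exfalso.
    by clear -e m1; lia.
  by clear -e n1; lia.
have l1E : l1 = a1.
  have [[_ e]|[]//|[_ e]] := z_count _ _ d1 m0; exfalso.
    by clear -e m1; lia.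
  by clear -e mlt; lia.
have l2E : l2 = a2.
  have [[_ e]|[_ e]|[]//] := z_count _ _ d2 n0; exfalso.
    by clear -e n1; lia.
  by clear -e mlt; lia.
have k1E : k1' = y1.
  by have [[]//|[_ e]] := y_count _ _ e1 m0; exfalso; clear -e mlt; lia.
have k2E : k2 = y2.
  by have [[_ e]|[]//] := y_count _ _ e2 isT; exfalso; clear -e mlt; lia.
exists (- (x1 + x2)), x1, x2; split=> // i.
rewrite xE yE l0E l1E l2E k1E k2E.
by have [] := sideP i => -[-> ->]; [constructor 1|constructor 2|constructor 3].
Qed.
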